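(* Let $n\ge1$, let $\beta\in(1,\infty)$, and let $V:\mathbb{R}^n\to\mathbb{R}$ be a $\beta$-homogeneous convex function such that $\nu$, with $d\nu\propto e^{-V}dx$, is a probability measure on $\mathbb{R}^n$. Let $t\in[0,1]$ and $p\in[0,\infty]$. Let $f,g,h:\mathbb{R}^n\to[0,\infty)$ be non-negative measurable functions, with $f$ and $g$ radially decreasing and $\nu$-integrable, such that $$h((1-t)x_0+tx_1)\ \ge\ M_p^t\big(f(x_0),g(x_1)\big)\qquad\text{for all }x_0,x_1\in\mathbb{R}^n.$$ Then $$\int h\,d\nu\ \ge\ M^t_{\frac{(\beta-1)p}{(\beta-1)+\beta np}}\Big(\int f\,d\nu,\ \int g\,d\nu\Big),$$ where the index $\frac{(\beta-1)p}{(\beta-1)+\beta np}$ is understood as $\frac{\beta-1}{\beta n}$ when $p=\infty$.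
   Context: A convex function $V:\mathbb{R}^n\to\mathbb{R}$ is $\beta$-homogeneous if $V(\lambda x)=\lambda^\beta V(x)$ for every $x\in\mathbb{R}^n$ and $\lambda>0$. The notation $d\nu\propto e^{-V}dx$ means that $\nu$ has Lebesgue density $e^{-V}/\int e^{-V}dx$ (with $\int e^{-V}dx<\infty$). A function $f:\mathbb{R}^n\to[0,\infty)$ is radially decreasing if it is non-increasing along rays from the origin, i.e. $f(sx)\ge f(x)$ for all $x\in\mathbb{R}^n$ and $s\in[0,1]$. For $x,y\ge0$, $t\in[0,1]$ and $p\in(-\infty,0)\cup(0,\infty)$, set $M_p^t(x,y)=\big((1-t)x^p+ty^p\big)^{1/p}$ if $xy>0$, and $M_p^t(x,y)=0$ otherwise. This is extended to $p\in\{-\infty,0,\infty\}$ by taking limits: if $xy>0$, then $M_{-\infty}^t(x,y)=\min\{x,y\}$, $M_0^t(x,y)=x^{1-t}y^t$, $M_\infty^t(x,y)=\max\{x,y\}$, and these are $0$ if $xy=0$. The integral $\int h\,d\nu$ takes values in $[0,\infty]$. *)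

(* Defs.v *)
From HB Require Import structures.
From mathcomp Require Import all_boot all_order all_algebra.
From mathcomp Require Import all_classical all_reals all_analysis.
Import Order.TTheory GRing.Theory Num.Theory.
Import numFieldNormedType.Exports.

Set Implicit Arguments.
Unset Strict Implicit.
Unset Printing Implicit Defensive.

Local Open Scope classical_set_scope.
Local Open Scope ring_scope.

(* The Borel sigma-algebra of R^n, generated by the coordinate functions, as in
   the library's instance for [n.-tuple R]. *)
Section measurable_rV.
Context {R : realType}.
Variable n : nat.

Let coord (i : 'I_n) (x : 'rV[R]_n) : measurableTypeR R := x ord0 i.

Let rV_set0 : g_sigma_preimage coord set0.
Proof. exact: sigma_algebra0. Qed.

Let rV_setC A : g_sigma_preimage coord A -> g_sigma_preimage coord (~` A).
Proof. exact: sigma_algebraC. Qed.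

Let rV_bigcup (F : (set 'rV[R]_n)^nat) :
  (forall i, g_sigma_preimage coord (F i)) ->
  g_sigma_preimage coord (\bigcup_i (F i)).
Proof. exact: sigma_algebra_bigcup. Qed.

HB.instance Definition _ := @isMeasurable.Build default_measure_display
  'rV[R]_n (g_sigma_preimage coord) rV_set0 rV_setC rV_bigcup.

Lemma measurable_coord_rV (i : 'I_n) :
  measurable_fun [set: 'rV[R]_n]
    ((fun x => x ord0 i) : 'rV[R]_n -> measurableTypeR R).
Proof.
move=> _ Y mY; rewrite setTI; apply: sub_sigma_algebra => /=.
rewrite -bigcup_seq/=; exists i => /=; first by rewrite mem_index_enum.
by exists Y => //; rewrite setTI.
Qed.

Lemma measurable_fun_rVP d (T : measurableType d) (f : T -> 'rV[R]_n) :
  (forall i, measurable_fun [set: T]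
    ((fun x => f x ord0 i) : T -> measurableTypeR R)) ->
  measurable_fun [set: T] f.
Proof.
move=> mf; suff H : preimage_set_system [set: T] f (@measurable _ 'rV[R]_n)
    `<=` measurable by move=> _ Y mY; apply: H; exists Y.
have -> : preimage_set_system [set: T] f (@measurable _ 'rV[R]_n) =
    g_sigma_preimage (fun i => coord i \o f).
  by rewrite g_sigma_preimage_comp.
apply: smallest_sub; first exact: sigma_algebra_measurable.
move=> A; rewrite -bigcup_seq => -[i _ [B mB <-]].
exact: (mf i).
Qed.

End measurable_rV.

Section cons_rV.
Context {R : realType} {n : nat}.
Local Notation Rb := (measurableTypeR R).

Definition cons_rV (p : Rb * 'rV[R]_n) : 'rV[R]_n.+1 :=
  row_mx (p.1 : R)%:M p.2.

Definition uncons_rV (x : 'rV[R]_n.+1) : Rb * 'rV[R]_n :=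
  (x ord0 ord0, \row_j x ord0 (lift ord0 j)).

Lemma cons_rV0 p : cons_rV p ord0 ord0 = p.1.
Proof.
rewrite /cons_rV mxE; case: splitP => // j _.
by rewrite (ord1 j) mxE eqxx mulr1n.
Qed.

Lemma cons_rVS p j : cons_rV p ord0 (lift ord0 j) = p.2 ord0 j.
Proof.
rewrite /cons_rV mxE; case: splitP => [k|k]; rewrite lift0.
  by rewrite (ord1 k).
by rewrite add1n => -[jk]; congr (p.2 ord0 _); exact: val_inj.
Qed.

Lemma cons_rVK : cancel cons_rV uncons_rV.
Proof.
move=> [a x]; rewrite /uncons_rV cons_rV0; congr pair.
by apply/rowP => j; rewrite mxE cons_rVS.
Qed.

Lemma uncons_rVK : cancel uncons_rV cons_rV.
Proof.
move=> x; apply/rowP => i; have [j ->|->] := unliftP ord0 i.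
  by rewrite cons_rVS mxE.
by rewrite cons_rV0.
Qed.

Lemma measurable_cons_rV : measurable_fun [set: Rb * 'rV[R]_n] cons_rV.
Proof.
apply: measurable_fun_rVP => i; have [j ->|->] := unliftP ord0 i.
- apply: (eq_measurable_fun (fun p : Rb * 'rV[R]_n => p.2 ord0 j : Rb)).
    by move=> p _; rewrite cons_rVS.
  exact: (measurableT_comp (measurable_coord_rV j) measurable_snd).
- apply: (eq_measurable_fun (fst : Rb * 'rV[R]_n -> Rb)).
    by move=> p _; rewrite cons_rV0.
  exact: measurable_fst.
Qed.

Lemma measurable_uncons_rV : measurable_fun [set: 'rV[R]_n.+1] uncons_rV.
Proof.
apply: measurable_fun_pair; first exact: measurable_coord_rV.
apply: measurable_fun_rVP => j.
apply: (eq_measurable_fun (fun x : 'rV[R]_n.+1 => x ord0 (lift ord0 j) : Rb)).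
  by move=> x _; rewrite /= mxE.
exact: measurable_coord_rV.
Qed.

End cons_rV.

Section lebesgue_rV_step.
Context {R : realType} {n : nat}.
Variable mu : {sigma_finite_measure set 'rV[R]_n -> \bar R}.
Local Open Scope ereal_scope.

Definition lebesgue_rV_step : set 'rV[R]_n.+1 -> \bar R :=
  pushforward (lebesgue_measure \x mu) cons_rV.

Let step0 : lebesgue_rV_step set0 = 0.
Proof. by rewrite /lebesgue_rV_step /pushforward preimage_set0 measure0. Qed.

Let step_ge0 A : 0 <= lebesgue_rV_step A.
Proof. exact: (measure_ge0 (lebesgue_measure \x mu)). Qed.

Let step_sigma_additive : semi_sigma_additive lebesgue_rV_step.
Proof.
move=> F mF tF mUF; rewrite /lebesgue_rV_step /pushforward preimage_bigcup.
apply: (@measure_semi_sigma_additive _ _ _ (lebesgue_measure \x mu)).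
- by move=> k; rewrite -[X in measurable X]setTI; exact: measurable_cons_rV.
- apply/trivIsetP => /= i j _ _ ij; rewrite -preimage_setI.
  by move/trivIsetP : tF => /(_ _ _ _ _ ij) ->//; rewrite preimage_set0.
- rewrite -preimage_bigcup -[X in measurable X]setTI.
  exact: measurable_cons_rV.
Qed.

HB.instance Definition _ := isMeasure.Build _ _ _ lebesgue_rV_step
  step0 step_ge0 step_sigma_additive.

Let step_sigma_finite : sigma_finite setT lebesgue_rV_step.
Proof.
have /sigma_finiteP[F [TF ndF Foo]] := sigma_finiteT (@lebesgue_measure R).
have /sigma_finiteP[G [TG ndG Goo]] := sigma_finiteT mu.
exists (fun k => uncons_rV @^-1` (F k `*` G k)).
  rewrite -preimage_bigcup (_ : \bigcup_k _ = setT) ?preimage_setT//.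
  apply/seteqP; split=> // -[x y] _.
  have [k _ Fkx] : (\bigcup_k F k) x by rewrite -TF.
  have [l _ Gly] : (\bigcup_k G k) y by rewrite -TG.
  exists (maxn k l) => //; split=> /=.
    by move: x Fkx; exact/subsetPset/ndF/leq_maxl.
  by move: y Gly; exact/subsetPset/ndG/leq_maxr.
move=> k; have [mF Fk] := Foo k; have [mG Gk] := Goo k; split.
  rewrite -[X in measurable X]setTI.
  by apply: measurable_uncons_rV => //; exact: measurableX.
rewrite /lebesgue_rV_step /pushforward -comp_preimage.
rewrite (_ : uncons_rV \o cons_rV = id); last first.
  by apply/funext => p /=; rewrite cons_rVK.
by rewrite preimage_id product_measure1E// lte_mul_pinfty// ge0_fin_numE.
Qed.

HB.instance Definition _ := Measure_isSigmaFinite.Build _ _ _ lebesgue_rV_step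
  step_sigma_finite.

End lebesgue_rV_step.

Fixpoint lebesgue_rV_rec (R : realType) (n : nat) :
    {sigma_finite_measure set 'rV[R]_n -> \bar R} :=
  if n is m.+1 then lebesgue_rV_step (lebesgue_rV_rec R m)
  else dirac (0 : 'rV[R]_0).

(* Lebesgue measure on the Borel sets of R^n: the n-fold product of
   [lebesgue_measure]. *)
Definition lebesgue_rV (R : realType) (n : nat) : set 'rV[R]_n -> \bar R :=
  lebesgue_rV_rec R n.
Arguments lebesgue_rV : clear implicits.

HB.instance Definition _ (R : realType) (n : nat) :=
  SigmaFiniteMeasure.on (lebesgue_rV R n).

Lemma lebesgue_rV_box (R : realType) (n : nat) (A : 'I_n -> set R) :
  (forall i, measurable (A i : set (measurableTypeR R))) ->
  lebesgue_rV R n [set x | forall i, A i (x ord0 i)] =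
  (\prod_(i < n) lebesgue_measure (A i))%E.
Proof.
elim: n A => [|n IH] A mA.
  rewrite big_ord0 /lebesgue_rV /= diracE mem_set//=.
  by case.
rewrite big_ord_recl -IH; last by move=> i; exact: mA.
pose B := [set x : 'rV[R]_n | forall i, A (lift ord0 i) (x ord0 i)].
have mB : measurable B.
  rewrite (_ : B = \big[setI/setT]_(i < n)
    ((fun x : 'rV[R]_n => x ord0 i : measurableTypeR R) @^-1` A (lift ord0 i))).
    apply: big_ind => // [|i _]; first exact: measurableI.
    rewrite -[X in measurable X]setTI.
    by apply: measurable_coord_rV => //; exact: mA.
  apply/seteqP; split=> x /=; rewrite -bigcap_seq /= => Bx i.
    by move=> _; exact: Bx.
  by apply: Bx; rewrite /= mem_index_enum.
rewrite -/B /lebesgue_rV /= /lebesgue_rV_step /pushforward.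
rewrite -(product_measure1E lebesgue_measure (lebesgue_rV_rec R n) (mA ord0) mB).
congr (product_measure1 _ _ _); apply/seteqP; split=> [[a x]|[a x] [/= Aa Ax] i].
  move=> /= H; split=> /=; first by have := H ord0; rewrite cons_rV0.
  by move=> i; have := H (lift ord0 i); rewrite cons_rVS.
have [j ->|->] := unliftP ord0 i; first by rewrite cons_rVS; exact: Ax.
by rewrite cons_rV0.
Qed.

(* R^n with the Lebesgue sigma-algebra, i.e. the completion of the Borel one. *)
Definition lebesgue_space (R : realType) (n : nat) : Type :=
  caratheodory_type ((lebesgue_rV R n)^*)%mu.

HB.instance Definition _ (R : realType) (n : nat) :=
  Measurable.on (lebesgue_space R n).

Definition completed_lebesgue_rV (R : realType) (n : nat) :
    set (lebesgue_space R n) -> \bar R :=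
  @completed_measure_extension _ 'rV[R]_n R (lebesgue_rV R n).
Arguments completed_lebesgue_rV : clear implicits.

HB.instance Definition _ (R : realType) (n : nat) :=
  Measure.on (completed_lebesgue_rV R n).

HB.instance Definition _ (R : realType) (n : nat) :=
  @Measure_isSigmaFinite.Build _ _ _ (completed_lebesgue_rV R n)
    (completed_measure_extension_sigma_finite
      (@sigma_finiteT _ 'rV[R]_n _ (lebesgue_rV R n))).

Lemma measurable_lebesgue_space (R : realType) (n : nat) (A : set 'rV[R]_n) :
  measurable A -> measurable (A : set (lebesgue_space R n)).
Proof. exact: caratheodory_measurable_mu_ext. Qed.

Lemma completed_lebesgue_rVE (R : realType) (n : nat) (A : set 'rV[R]_n) :
  measurable A -> completed_lebesgue_rV R n A = lebesgue_rV R n A.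
Proof. exact: (@measurable_mu_extE _ R 'rV[R]_n (lebesgue_rV R n)). Qed.

Section gibbs.
Context {R : realType} {n : nat}.
Implicit Types (V f : 'rV[R]_n -> R).

Definition homogeneous_fun (beta : R) V :=
  forall x (lambda : R), 0 < lambda -> V (lambda *: x) = lambda `^ beta * V x.

Definition radially_decreasing f :=
  forall x (s : R), 0 <= s <= 1 -> f x <= f (s *: x).

(* d nu = e^{-V} dx / Z, where Z = \int e^{-V} dx is finite. *)
Definition gibbs_measure V (nu : {measure set (lebesgue_space R n) -> \bar R}) :=
  let Z := (\int[completed_lebesgue_rV R n]_x (expR (- V x))%:E)%E in
  (Z < +oo)%E /\
  forall A : set (lebesgue_space R n), measurable A ->
    nu A = (\int[completed_lebesgue_rV R n]_(x in A)
              (expR (- V x) / fine Z)%:E)%E.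

End gibbs.

(* M_p^t(x, y) for x, y >= 0. *)
Definition power_mean {R : realType} (p : \bar R) (t x y : R) : R :=
  if 0 < x * y then
    match p with
    | +oo%E => Num.max x y
    | -oo%E => Num.min x y
    | r%:E => if r == 0 then x `^ (1 - t) * y `^ t
              else ((1 - t) * x `^ r + t * y `^ r) `^ r^-1
    end
  else 0.

(* The index (beta - 1)p / ((beta - 1) + beta n p), extended by its limit at
   infinite p; the value at -oo is irrelevant. *)
Definition mean_index {R : realType} (n : nat) (beta : R) (p : \bar R) : \bar R :=
  match p with
  | r%:E => ((beta - 1) * r / ((beta - 1) + beta * n%:R * r))%:E
  | _ => ((beta - 1) / (beta * n%:R))%:E
  end.

(* Main.v *)
(** Put [q = beta / (beta - 1)] and [m = 1 - l], and let [a, b > 0] satisfy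
    [m a^q + l b^q = 1]. Convexity with the weights [m a^q] and [l b^q],
    together with homogeneity, gives
      [V (m y0 + l y1) <= m V (y0 / a) + l V (y1 / b)],
    so the Prekopa-Leindler inequality with weight [l], applied to
    [f (y / a) e^{-V (y / a)}] and [g (y / b) e^{-V (y / b)}], bounds [int h dnu]
    below by [(a^n int f)^m (b^n int g)^l] as soon as
      [f(x)^m g(y)^l <= h (m a x + l b y)].
    Write [1 - t = m c] and [t = l d]. If [a <= c] and [b <= d], then
    [m a x + l b y = (1 - t) (a/c) x + t (b/d) y], and radial monotonicity reduces
    this condition to the hypothesis on [h], where by AM-GM
      [M_p^t (u, v) >= (c^{1/p} u)^m (d^{1/p} v)^l].
    One can choose such [a] and [b] with [a^m b^l >= (c^m d^l)^q], so that
      [int h >= (c^{1/p + n q} int f)^m (d^{1/p + n q} int g)^l].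
    For [l] proportional to [t (int g)^r], where [1/r = 1/p + n q], the right-hand
    side is exactly [M_r^t (int f, int g)]. *)

Require Import Defs.
From HB Require Import structures.
From mathcomp Require Import all_boot all_order all_algebra.
From mathcomp Require Import all_classical all_reals all_analysis.
From mathcomp Require Import measurable_realfun ring lra.
Import Order.TTheory GRing.Theory Num.Theory.
Import numFieldNormedType.Exports.

Set Implicit Arguments.
Unset Strict Implicit.
Unset Printing Implicit Defensive.

Local Open Scope classical_set_scope.
Local Open Scope ring_scope.

(** * One-dimensional Lebesgue measure and the Brunn-Minkowski inequality *)

(** The obstacle is measurability. [f], [g] and [h] are only Lebesgue measurable, so their slices
    need not be measurable, while the Prekopa-Leindler inequality is proved by slicing and hence for
    Borel functions. Off a common Borel null set all three are Borel; on it [f] and [g] are replaced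
    by 0 and [h] by [+oo]. This changes no integral and keeps the pointwise inequality. It may
    destroy radial monotonicity, which is therefore applied to the original functions. Values in
    [\bar R] serve this replacement, and they also admit the infinite slice integrals that arise in
    the induction on the dimension. The pair [a], [b] comes from saturating one constraint: if
    [c <= d], put [a = c] and let [m a^q + l b^q = 1] determine [b]. The bound on [a^m b^l] is an
    equality at [c = 1] and is propagated to smaller [c] by a derivative. *)

Lemma lebesgue_measure_affine (R : realType) (a v : R) (A : set R) :
  0 < a -> measurable (A : set (measurableTypeR R)) ->
  lebesgue_measure ((fun x => a * x + v) @^-1` A) =
  ((a^-1)%:E * lebesgue_measure A)%E.
Proof.
move=> a0 mA.
pose phi : measurableTypeR R -> measurableTypeR R := fun x => a * x + v.
have mphi : measurable_fun [set: measurableTypeR R] phi.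
  by apply: measurable_funD => //; exact: mulrl_measurable.
suff H : lebesgue_measure A = (a%:E * lebesgue_measure (phi @^-1` A))%E.
  rewrite -/phi H muleA -EFinM mulVf ?gt_eqF// mul1e //.
pose nu : {measure set (measurableTypeR R) -> \bar R} := pushforward (@lebesgue_measure R) phi.
pose mu2 : {measure set (measurableTypeR R) -> \bar R} :=
  mscale (NngNum (ltW a0)) (nu mphi).
transitivity (mu2 A); last by [].
(* [mu2] is scaled so that half-open intervals get their length, and these determine Lebesgue
   measure. *)
apply: lebesgue_measure_unique => // _ [[x y] /= xy <-].
rewrite /mu2 /= /mscale /= /pushforward /=.
have -> : phi @^-1` `]x, y]%classic = `](x - v) / a, (y - v) / a]%classic.
  apply/seteqP; split=> z; rewrite /= !in_itv /= /phi ltr_pdivrMr// ler_pdivlMr//;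
   rewrite ltrBlDr lerBrDr mulrC //.
rewrite !lebesgue_measure_itv /= !lte_fin ltr_pM2r ?invr_gt0// ltrD2r.
case: ifP => // _; last by rewrite mule0.
rewrite -!EFinD -EFinM; congr (_%:E); field; rewrite gt_eqF//.
Qed.

(** The rays ending at points of [A] exhaust [A] except possibly for its supremum, a single null
    point. In [brunn_minkowski1] this replaces compactness: suprema need not be attained. *)
Lemma lebesgue_measure_le_lt_rays (R : realType) (A : set R) (c : \bar R) :
  measurable (A : set (measurableTypeR R)) ->
  (forall a, A a -> (lebesgue_measure (A `&` `]-oo, a[%classic) <= c)%E) ->
  A !=set0 -> (lebesgue_measure A <= c)%E.
Proof.
move=> mA Ac [a0 Aa0].
have core (u : R^nat) (S : R) : nondecreasing_seq u ->
    (forall k, exists2 a, A a & u k <= a) ->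
    A `\ S `<=` \bigcup_k `]-oo, u k[%classic -> (lebesgue_measure A <= c)%E.
  move=> ndu uA AU.
  pose F k : set (measurableTypeR R) := A `&` `]-oo, u k[%classic.
  have mF k : measurable (F k) by apply: measurableI => //; exact: measurable_itv.
  have mUF : measurable (\bigcup_k F k) by exact: bigcupT_measurable.
  have ndF : nondecreasing_seq F.
    move=> i j ij; apply/subsetPset => x [Ax]; rewrite /= in_itv /= => xu.
    by split => //; rewrite /= in_itv /=; apply: (lt_le_trans xu); exact: ndu.
  have cF := @nondecreasing_cvg_mu _ _ _ (@lebesgue_measure R) _ mF mUF ndF.
  have UFc : (lebesgue_measure (\bigcup_k F k) <= c)%E.
    rewrite -(cvg_lim _ cF)//; apply: lime_le.
      by apply/cvg_ex; eexists; exact: cF.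
    apply: nearW => k; have [a Aa ua] := uA k.
    apply: le_trans (Ac _ Aa); apply: le_measure; rewrite ?inE//.
      by apply: measurableI => //; exact: measurable_itv.
    move=> x [Ax]; rewrite /= in_itv /= => xu.
    by split => //; rewrite /= in_itv /=; apply: (lt_le_trans xu).
  apply: le_trans UFc.
  apply: (@le_trans _ _ (lebesgue_measure (\bigcup_k F k `|` [set S]))).
    apply: le_measure; rewrite ?inE//.
      by apply: measurableU => //; exact: measurable_set1.
    move=> x Ax; have [->|/eqP xS] := eqVneq x S; first by right.
    have [k _ xk] := AU x (conj Ax xS).
    by left; exists k.
  apply: (@le_trans _ _ (lebesgue_measure (\bigcup_k F k) + lebesgue_measure [set S])%E).
    by apply: measureU2 => //; exact: measurable_set1.
  by rewrite lebesgue_measure_set1 adde0.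
have [ubA|nubA] := pselect (has_ubound A); last first.
  (* Without an upper bound there is no supremum to remove; 0 is a dummy. *)
  apply: (core (fun k => k%:R) 0).
  - by move=> i j ij; rewrite ler_nat.
  - move=> k; apply: contrapT => kA; apply: nubA; exists k%:R => x Ax.
    by rewrite leNgt; apply/negP => kx; apply: kA; exists x => //; exact: ltW.
  - move=> x _; exists (Num.truncn `|x|).+1 => //=; rewrite in_itv /=.
    by apply: (le_lt_trans (ler_norm x)); apply: truncnS_gt.
have sA : has_sup A by split; [exists a0|].
apply: (core (fun k => sup A - k.+1%:R^-1) (sup A)).
- move=> i j ij; rewrite lerD2l lerN2 lef_pV2 ?posrE ?ltr0n//.
  by rewrite ler_nat.
- move=> k; have [|a Aa ka] := @sup_adherent _ A k.+1%:R^-1 _ sA.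
    by rewrite invr_gt0 ltr0n.
  by exists a => //; exact: ltW.
- move=> x [Ax xS]; have xS' : x < sup A.
    rewrite lt_neqAle; apply/andP; split; first exact/eqP.
    by apply: sup_upper_bound.
  exists (Num.truncn (sup A - x)^-1) => //=; rewrite in_itv /=.
  rewrite ltrBrDr -ltrBrDl -[ltRHS]invrK ltf_pV2 ?posrE ?ltr0n ?invr_gt0 ?subr_gt0//.
  exact: truncnS_gt.
Qed.

Lemma lebesgue_measure_le_gt_rays (R : realType) (A : set R) (c : \bar R) :
  measurable (A : set (measurableTypeR R)) ->
  (forall a, A a -> (lebesgue_measure (A `&` `]a, +oo[%classic) <= c)%E) ->
  A !=set0 -> (lebesgue_measure A <= c)%E.
Proof.
move=> mA Ac [a0 Aa0].
have mN B : measurable (B : set (measurableTypeR R)) ->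
    measurable (-%R @^-1` B : set (measurableTypeR R)).
  move=> mB; rewrite -[X in measurable X]setTI.
  by apply: oppr_measurable => //.
rewrite -(lebesgue_measureN mA) /pushforward.
apply: lebesgue_measure_le_lt_rays; first exact: mN.
- move=> a /= ANa; apply: le_trans (Ac _ ANa).
  rewrite -(@lebesgue_measureN _ (A `&` _)) /pushforward; last first.
    by apply: measurableI => //; exact: measurable_itv.
  apply: le_measure; rewrite ?inE.
  + by apply: measurableI; [exact: mN|exact: measurable_itv].
  + by apply: mN; apply: measurableI => //; exact: measurable_itv.
  + by move=> x [ANx]; rewrite /= !in_itv /= => xa; rewrite andbT ltrN2.
- by exists (- a0); rewrite /= opprK.
Qed.

(** For compact sets one aligns the last point of [A] with the first point of [B]. Here arbitrary
    [a] in [A] and [b] in [B] take their place: the part of [A] left of [a] and the part of [B]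
    right of [b] are moved into disjoint parts of [C], and then [a] goes up and [b] goes down. *)
Lemma brunn_minkowski1 (R : realType) (l : R) (A B C : set R) :
  0 < l < 1 ->
  measurable (A : set (measurableTypeR R)) ->
  measurable (B : set (measurableTypeR R)) ->
  measurable (C : set (measurableTypeR R)) ->
  A !=set0 -> B !=set0 ->
  (forall a b, A a -> B b -> C ((1 - l) * a + l * b)) ->
  ((1 - l)%:E * lebesgue_measure A + l%:E * lebesgue_measure B <=
   lebesgue_measure C)%E.
Proof.
move=> /andP[l0 l1] mA mB mC A0 B0 ABC.
have m0 : 0 < 1 - l by rewrite subr_gt0.
have [Cfin|] := boolP (lebesgue_measure C \is a fin_num); last first.
  by rewrite ge0_fin_numE// -leNgt leye_eq => /eqP ->; rewrite leey.
(* The translates of the two pieces below lie on either side of the point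
   [(1 - l) a + l b]. *)
have rays a b : A a -> B b -> ((1 - l)%:E * lebesgue_measure (A `&` `]-oo, a[%classic) +
    l%:E * lebesgue_measure (B `&` `]b, +oo[%classic) <= lebesgue_measure C)%E.
  move=> Aa Bb.
  pose A1 : set (measurableTypeR R) :=
    (fun x => (1 - l)^-1 * x + (- ((1 - l)^-1 * (l * b)))) @^-1` (A `&` `]-oo, a[%classic).
  pose B1 : set (measurableTypeR R) :=
    (fun x => l^-1 * x + (- (l^-1 * ((1 - l) * a)))) @^-1` (B `&` `]b, +oo[%classic).
  have mAa : measurable (A `&` `]-oo, a[%classic : set (measurableTypeR R)).
    by apply: measurableI => //; exact: measurable_itv.
  have mBb : measurable (B `&` `]b, +oo[%classic : set (measurableTypeR R)).
    by apply: measurableI => //; exact: measurable_itv.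
  have maff (u v : R) (D : set R) : measurable (D : set (measurableTypeR R)) ->
      measurable ((fun x => u * x + v) @^-1` D : set (measurableTypeR R)).
    move=> mD; rewrite -[X in measurable X]setTI.
    have : measurable_fun [set: measurableTypeR R]
        (fun x : measurableTypeR R => u * x + v : measurableTypeR R).
      by apply: measurable_realfun.measurable_funD => //; exact: mulrl_measurable.
    exact.
  have mA1 : measurable A1 by exact: maff.
  have mB1 : measurable B1 by exact: maff.
  have <- : lebesgue_measure A1 = ((1 - l)%:E * lebesgue_measure (A `&` `]-oo, a[%classic))%E.
    by rewrite /A1 lebesgue_measure_affine// ?invr_gt0// invrK.
  have <- : lebesgue_measure B1 = (l%:E * lebesgue_measure (B `&` `]b, +oo[%classic))%E.
    by rewrite /B1 lebesgue_measure_affine// ?invr_gt0// invrK.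
  have A1E x : A1 x -> A ((x - l * b) / (1 - l)) /\ x < (1 - l) * a + l * b.
    move=> [Ax]; rewrite /= in_itv /= => xa.
    have e : (1 - l)^-1 * x - (1 - l)^-1 * (l * b) = (x - l * b) / (1 - l).
      by rewrite -mulrBr mulrC.
    rewrite e in Ax xa; split => //.
    by move: xa; rewrite ltr_pdivrMr// ltrBlDr mulrC.
  have B1E x : B1 x -> B ((x - (1 - l) * a) / l) /\ (1 - l) * a + l * b < x.
    move=> [Bx]; rewrite /= in_itv /= andbT => xb.
    have e : l^-1 * x - l^-1 * ((1 - l) * a) = (x - (1 - l) * a) / l.
      by rewrite -mulrBr mulrC.
    rewrite e in Bx xb; split => //.
    by move: xb; rewrite ltr_pdivlMr// ltrBrDl (mulrC b).
  rewrite -measureU//; last first.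
    apply/seteqP; split => // x [/A1E[_ xp] /B1E[_ px]].
    by have := lt_trans xp px; rewrite ltxx.
  apply: le_measure; rewrite ?inE//; first exact: measurableU.
  move=> x [/A1E[Ax _]|/B1E[Bx _]].
    rewrite (_ : x = (1 - l) * ((x - l * b) / (1 - l)) + l * b); first exact: ABC.
    field; exact: lt0r_neq0.
  rewrite (_ : x = (1 - l) * a + l * ((x - (1 - l) * a) / l)); first exact: ABC.
  by field; exact: lt0r_neq0.
have fin_ray k (D : set R) : 0 < k -> (k%:E * lebesgue_measure D <= lebesgue_measure C ->
    k%:E * lebesgue_measure D \is a fin_num)%E.
  move=> k0 Dk; rewrite ge0_fin_numE; last by rewrite mule_ge0// lee_fin ltW.
  by rewrite (le_lt_trans Dk)// ltey_eq Cfin.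
(* The points are released one at a time, first [a] and then [b]; [fin_ray] makes the other term
   finite, so that it can be subtracted. *)
have step b : B b -> ((1 - l)%:E * lebesgue_measure A +
    l%:E * lebesgue_measure (B `&` `]b, +oo[%classic) <= lebesgue_measure C)%E.
  move=> Bb.
  have fb : (l%:E * lebesgue_measure (B `&` `]b, +oo[%classic) \is a fin_num)%E.
    have [a Aa] := A0; apply: fin_ray => //; apply: le_trans (rays _ _ Aa Bb).
    by rewrite leeDr// mule_ge0// lee_fin ltW.
  rewrite -leeBrDr// muleC -lee_pdivlMr//.
  apply: lebesgue_measure_le_lt_rays => // a Aa.
  rewrite lee_pdivlMr// muleC leeBrDr//; exact: rays.
have fA : ((1 - l)%:E * lebesgue_measure A \is a fin_num)%E.
  have [b Bb] := B0; apply: fin_ray => //; apply: le_trans (step _ Bb).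
  by rewrite leeDl// mule_ge0// lee_fin ltW.
rewrite -leeBrDl// muleC -lee_pdivlMr//.
apply: lebesgue_measure_le_gt_rays => // b Bb.
rewrite lee_pdivlMr// muleC leeBrDl//; exact: step.
Qed.

(** * The Prekopa-Leindler inequality *)

Section layer_cake.
Context d (T : measurableType d) (R : realType).
Variable mu : {sigma_finite_measure set T -> \bar R}.
Variable f : T -> \bar R.
Hypothesis mf : measurable_fun [set: T] f.
Hypothesis f0 : forall x, (0 <= f x)%E.

Let hyp : set (T * measurableTypeR R) :=
  [set z | (0 : R) < z.2 /\ ((z.2 : R)%:E < f z.1)%E].

Let mhyp : measurable hyp.
Proof.
have m2 : measurable_fun [set: T * measurableTypeR R]
    (fun z : T * measurableTypeR R => (z.2 : R)%:E).
  by apply/measurable_EFinP; exact: measurable_snd.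
have m1 : measurable_fun [set: T * measurableTypeR R]
    (fun z : T * measurableTypeR R => f z.1).
  by apply: measurableT_comp => //; exact: measurable_fst.
have := measurableI _ _ (measurable_lte measurableT (measurable_cst 0%E) m2)
  (measurable_lte measurableT m2 m1).
by rewrite !setTI; congr measurable; apply/seteqP; split=> [[x s]|[x s]].
Qed.

Let ysec (s : R) : ysection hyp s = [set x | (0 : R) < s /\ (s%:E < f x)%E].
Proof. by apply/seteqP; split=> x; rewrite /ysection /= ?inE. Qed.

Lemma measurable_fun_superlevel : measurable_fun [set: measurableTypeR R]
  (fun s : R => mu [set x | (0 : R) < s /\ (s%:E < f x)%E]).
Proof.
have := measurable_fun_ysection mu mhyp.
by apply: eq_measurable_fun => s _ /=; rewrite ysec.
Qed.

(** Tonelli on the region below the graph. Heights are kept positive because [s] runs over the whole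
    line; the section over [x] is then the interval from 0 to [f x]. *)
Lemma layer_cake : (\int[mu]_x f x =
  \int[lebesgue_measure]_s mu [set x | ((0 : R) < s)%R /\ s%:E < f x])%E.
Proof.
have := @indic_fubini_tonelli _ _ _ _ _ mu (@lebesgue_measure R) _ mhyp.
rewrite indic_fubini_tonelli_FE// indic_fubini_tonelli_GE//= => H.
transitivity (\int[mu]_x lebesgue_measure (xsection hyp x))%E; last first.
  by rewrite H; apply: eq_integral => s _ /=; rewrite ysec.
apply: eq_integral => x _.
have := f0 x; case fx : (f x) => [r| |]// r0.
- have -> : xsection hyp x = `]0, r[%classic.
    apply/seteqP; split=> s; rewrite /xsection /= inE /hyp /= fx in_itv /= lte_fin.
      by move=> [-> ->].
    by move=> /andP[].
  rewrite lebesgue_measure_itv /= lte_fin; case: ltP => [_|r0'].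
    by rewrite sube0.
  by congr (_%:E); apply/eqP; rewrite eq_le r0' -lee_fin.
- have -> : xsection hyp x = `]0, +oo[%classic.
    apply/seteqP; split=> s; rewrite /xsection /= inE /hyp /= fx in_itv /= andbT.
      by move=> [].
    by move=> ->; rewrite ltry.
  by rewrite lebesgue_measure_itv /= lt0y.
Qed.

End layer_cake.

Lemma poweRM_amgm (R : realType) (l : R) (x y : \bar R) : 0 < l < 1 ->
  (0 <= x -> 0 <= y ->
   x `^ (1 - l) * y `^ l <= (1 - l)%:E * x + l%:E * y)%E.
Proof.
move=> /andP[l0 l1]; have m0 : 0 < 1 - l by rewrite subr_gt0.
case: x => [x| |]//; case: y => [y| |]//; rewrite ?lee_fin => x0 y0.
- have := @conjugate_powR R (x `^ (1 - l)) (y `^ l) (1 - l)^-1 l^-1.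
  rewrite !powR_ge0 !invr_gt0 m0 l0 !invrK subrK => /(_ isT isT isT isT erefl).
  by rewrite -!powRrM !mulfV ?gt_eqF// !powRr1// (mulrC x) (mulrC y).
- by rewrite [X in (_ <= _ + X)%E]mulry gtr0_sg// mul1e addey// leey.
- by rewrite [X in (_ <= X + _)%E]mulry gtr0_sg// mul1e addye// leey.
- by rewrite [X in (_ <= X + _)%E]mulry gtr0_sg// mul1e addye ?leey// mulry gtr0_sg// mul1e.
Qed.

(** Multiplication in [\bar R] is not continuous at the pair 0, [+oo], so the limit is taken through
    the order: a positive finite [y] is divided out, and if [y = +oo] then [c < +oo] forces every
    [u k] to vanish. *)
Lemma poweR_lim_le (R : realType) (a : R) (u : (\bar R)^nat) (I y c : \bar R) :
  0 < a -> (forall k, 0 <= u k)%E -> u @ \oo --> I -> (0 <= y)%E ->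
  (forall k, u k `^ a * y <= c)%E -> (I `^ a * y <= c)%E.
Proof.
move=> a0 u0 uI y0 uc.
have I0 : (0 <= I)%E.
  rewrite -(cvg_lim _ uI)//; apply: lime_ge; first by apply/cvg_ex; exists I.
  exact: nearW.
have powK z : (0 <= z -> (z `^ a) `^ a^-1 = z)%E.
  by move=> z0; rewrite -poweRrM mulfV ?gt_eqF// poweRe1.
have powK' z : (0 <= z -> (z `^ a^-1) `^ a = z)%E.
  by move=> z0; rewrite -poweRrM mulVf ?gt_eqF// poweRe1.
have mono b x z : 0 <= b -> (0 <= x -> x <= z -> x `^ b <= z `^ b)%E.
  move=> b0 x0 xz; apply: gt0_ler_poweR => //; rewrite in_itv /= leey andbT//.
  exact: le_trans xz.
have c0 : (0 <= c)%E by apply: le_trans (uc 0%N); rewrite mule_ge0// poweR_ge0.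
have lim_le D : (0 <= D)%E -> (forall k, u k `^ a <= D)%E -> (I `^ a <= D)%E.
  move=> D0 uD; rewrite -(powK' D)//; apply: (mono) => //; first exact: ltW.
  rewrite -(cvg_lim _ uI)//; apply: lime_le; first by apply/cvg_ex; exists I.
  by apply: nearW => k; rewrite -(powK (u k))// mono ?invr_ge0 ?poweR_ge0// ltW.
have [->|yneq0] := eqVneq y 0%E; first by rewrite mule0.
case: y y0 uc yneq0 => [y| |]//.
- rewrite lee_fin eqe => y0 uc yneq0.
  have {}y0 : 0 < y by rewrite lt_neqAle eq_sym yneq0.
  rewrite -lee_pdivlMr//; apply: lim_le => [|k]; last by rewrite lee_pdivlMr.
  by rewrite mule_ge0// lee_fin invr_ge0 ltW.
- move=> _ uc _; have [->|cy] := eqVneq c +oo%E; first exact: leey.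
  suff : (I `^ a <= 0)%E.
    rewrite le_eqVlt ltNge poweR_ge0 orbF => /eqP ->.
    by rewrite mul0e.
  apply: lim_le => // k; rewrite leNgt; apply/negP => uk0.
  by have := uc k; rewrite gt0_muley// leye_eq (negbTE cy).
Qed.

(** Both suprema equal 1, so at every level strictly between 0 and 1 the two superlevel sets are
    nonempty and Brunn-Minkowski applies; integration over the level gives the sum. *)
Lemma prekopa_leindler1_sum (R : realType) (l : R)
    (f g h : measurableTypeR R -> \bar R) : 0 < l < 1 ->
  measurable_fun setT f -> measurable_fun setT g -> measurable_fun setT h ->
  (forall x, 0 <= f x <= 1)%E -> (forall x, 0 <= g x <= 1)%E ->
  (forall x, 0 <= h x)%E ->
  (forall s, 0 < s < 1 -> exists x, (s%:E < f x)%E) ->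
  (forall s, 0 < s < 1 -> exists x, (s%:E < g x)%E) ->
  (forall (s x y : R), 0 < s < 1 -> (s%:E < f x)%E -> (s%:E < g y)%E ->
    (s%:E < h ((1 - l) * x + l * y)%R)%E) ->
  ((1 - l)%:E * \int[lebesgue_measure]_x f x +
   l%:E * \int[lebesgue_measure]_x g x <= \int[lebesgue_measure]_x h x)%E.
Proof.
move=> l01 mf mg mh f01 g01 h0 supf supg fgh.
have /andP[l0 l1] := l01; have m0 : 0 < 1 - l by rewrite subr_gt0.
have f0 x : (0 <= f x)%E by have /andP[] := f01 x.
have g0 x : (0 <= g x)%E by have /andP[] := g01 x.
rewrite (layer_cake lebesgue_measure mf f0) (layer_cake lebesgue_measure mg g0).
rewrite (layer_cake lebesgue_measure mh h0).
have mL (k : measurableTypeR R -> \bar R) (s : R) : measurable_fun setT k ->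
    measurable ([set x | (0 : R) < s /\ (s%:E < k x)%E] : set (measurableTypeR R)).
  move=> mk; have [s0|s0] := boolP (0 < s); last first.
    rewrite (_ : [set _ | _] = set0)//; by apply/seteqP; split => // x [].
  have := measurable_lte measurableT (measurable_cst s%:E) mk.
  by rewrite setTI; congr measurable; apply/seteqP; split => x //= [].
rewrite -!ge0_integralZl//; do ?[by rewrite lee_fin ltW];
  do ?exact: measurable_fun_superlevel.
rewrite -ge0_integralD//; last 4 first.
- by move=> s _; rewrite mule_ge0// lee_fin ltW.
- by apply: measurable_funeM; exact: measurable_fun_superlevel.
- by move=> s _; rewrite mule_ge0// lee_fin ltW.
- by apply: measurable_funeM; exact: measurable_fun_superlevel.
apply: ge0_le_integral => //.
- by move=> s _; rewrite adde_ge0// mule_ge0// lee_fin ltW.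
- by apply: emeasurable_funD; apply: measurable_funeM; exact: measurable_fun_superlevel.
- exact: measurable_fun_superlevel.
move=> s _; have [s01|s01] := boolP (0 < s < 1).
  have /andP[s0 s1] := s01.
  apply: brunn_minkowski1 => //; try exact: mL.
  - by have [x sx] := supf _ s01; exists x.
  - by have [x sx] := supg _ s01; exists x.
  - by move=> x y [_ sx] [_ sy]; split => //; exact: fgh.
have empty (k : measurableTypeR R -> \bar R) : (forall x, k x <= 1)%E ->
    [set x | (0 : R) < s /\ (s%:E < k x)%E] = set0.
  move=> k1; apply/seteqP; split => // x [s0 sk]; move: s01; rewrite s0 /=.
  by have := lt_le_trans sk (k1 x); rewrite lte_fin => ->.
have f1 x : (f x <= 1)%E by have /andP[] := f01 x.
have g1 x : (g x <= 1)%E by have /andP[] := g01 x.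
by rewrite (empty f f1) (empty g g1) measure0 !mule0 adde0.
Qed.

Lemma le_poweR (R : realType) (r : R) (x y : \bar R) : 0 <= r ->
  (0 <= x -> x <= y -> x `^ r <= y `^ r)%E.
Proof.
move=> r0 x0 xy; apply: gt0_ler_poweR => //; rewrite in_itv /= leey andbT//.
exact: le_trans xy.
Qed.

Lemma integral_sup_eq0 d (T : measurableType d) (R : realType)
    (mu : {measure set T -> \bar R}) (f : T -> \bar R) :
  (forall x, 0 <= f x)%E -> (ereal_sup (range f) <= 0)%E ->
  (\int[mu]_x f x = 0)%E.
Proof.
move=> f0 supf; apply: integral0_eq => x _; apply/eqP; rewrite eq_le f0 andbT.
by apply: le_trans supf; apply: ereal_sup_ubound; exists x.
Qed.

(** Boundedness makes the suprema real, and dividing by them reaches the normalised case. AM-GM then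
    turns the sum into a product, from which the normalising factors cancel. *)
Lemma prekopa_leindler1_bounded (R : realType) (l k : R)
    (f g h : measurableTypeR R -> \bar R) : 0 < l < 1 ->
  measurable_fun setT f -> measurable_fun setT g -> measurable_fun setT h ->
  (forall x, 0 <= f x <= k%:E)%E -> (forall x, 0 <= g x <= k%:E)%E ->
  (forall x, 0 <= h x)%E ->
  (forall x y : R, f x `^ (1 - l) * g y `^ l <= h ((1 - l) * x + l * y)%R)%E ->
  ((\int[lebesgue_measure]_x f x) `^ (1 - l) *
   (\int[lebesgue_measure]_x g x) `^ l <= \int[lebesgue_measure]_x h x)%E.
Proof.
move=> l01 mf mg mh f0k g0k h0 fgh.
have /andP[l0 l1] := l01; have m0 : 0 < 1 - l by rewrite subr_gt0.
have f0 x : (0 <= f x)%E by have /andP[] := f0k x.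
have g0 x : (0 <= g x)%E by have /andP[] := g0k x.
have ih0 : (0 <= \int[lebesgue_measure]_x h x)%E by exact: integral_ge0.
have supE (u : measurableTypeR R -> \bar R) : (forall x, 0 <= u x <= k%:E)%E ->
    (ereal_sup (range u) <= 0)%E \/
    exists2 a : R, 0 < a & ereal_sup (range u) = a%:E.
  move=> u0k; have [|sup_gt0] := leP (ereal_sup (range u)) 0%E; first by left.
  right; have : (ereal_sup (range u) <= k%:E)%E.
    by apply: ge_ereal_sup => _ [x _ <-]; have /andP[] := u0k x.
  case: (ereal_sup (range u)) sup_gt0 => [a| |]//.
  by rewrite lte_fin => a0 _; exists a.
have [F0|[a a0 Fa]] := supE _ f0k.
  by rewrite (integral_sup_eq0 _ f0 F0) poweR0r ?gt_eqF// mul0e.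
have [G0|[b b0 Gb]] := supE _ g0k.
  by rewrite (integral_sup_eq0 _ g0 G0) poweR0r ?gt_eqF// mule0.
(* Dividing [f], [g], [h] by [a], [b], [c] respectively preserves the pointwise hypothesis. *)
pose c := a `^ (1 - l) * b `^ l.
have c0 : 0 < c by rewrite mulr_gt0// powR_gt0.
have norm01 (u : measurableTypeR R -> \bar R) (e : R) : 0 < e ->
    (forall x, 0 <= u x)%E -> ereal_sup (range u) = e%:E ->
    (forall x, 0 <= e^-1%:E * u x <= 1)%E.
  move=> e0 u0 ue x; rewrite mule_ge0 ?lee_fin ?invr_ge0 ?(ltW e0)//=.
  rewrite muleC lee_pdivrMr// mul1e -ue; apply: ereal_sup_ubound.
  by exists x.
have normsup (u : measurableTypeR R -> \bar R) (e : R) : 0 < e ->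
    ereal_sup (range u) = e%:E ->
    forall s, 0 < s < 1 -> exists x, (s%:E < e^-1%:E * u x)%E.
  move=> e0 ue s /andP[s0 s1].
  have : ((s * e)%:E < ereal_sup (range u))%E.
    by rewrite ue lte_fin gtr_pMl.
  move=> /ereal_sup_gt[_ [x _ <-]] sx; exists x.
  by rewrite muleC lte_pdivlMr// -EFinM.
have key : ((1 - l)%:E * \int[lebesgue_measure]_x (a^-1%:E * f x) +
   l%:E * \int[lebesgue_measure]_x (b^-1%:E * g x) <=
   \int[lebesgue_measure]_x (c^-1%:E * h x))%E.
  apply: prekopa_leindler1_sum => //.
  - exact: measurable_funeM.
  - exact: measurable_funeM.
  - exact: measurable_funeM.
  - exact: norm01.
  - exact: norm01.
  - by move=> x; rewrite mule_ge0// lee_fin invr_ge0 ltW.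
  - exact: normsup.
  - exact: normsup.
  - move=> s x y /andP[s0 s1]; rewrite !(muleC _^-1%:E).
    rewrite !lte_pdivlMr// -!EFinM => sx sy.
    apply: lt_le_trans (fgh x y).
    have fx : f x \is a fin_num.
      by rewrite ge0_fin_numE// (@le_lt_trans _ _ k%:E) ?ltry//; have /andP[] := f0k x.
    have gy : g y \is a fin_num.
      by rewrite ge0_fin_numE// (@le_lt_trans _ _ k%:E) ?ltry//; have /andP[] := g0k y.
    move: sx sy; rewrite -(fineK fx) -(fineK gy) !poweR_EFin -EFinM !lte_fin.
    move=> sx sy.
    have -> : s * c = (s * a) `^ (1 - l) * (s * b) `^ l.
      rewrite !powRM ?(ltW s0) ?(ltW a0) ?(ltW b0)// mulrACA -powRD ?subrK ?powRr1 ?(ltW s0)//.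
      by rewrite gt_eqF// implybT.
    have sa0 : 0 <= s * a by rewrite mulr_ge0// ltW.
    have sb0 : 0 <= s * b by rewrite mulr_ge0// ltW.
    apply: ltr_pM; rewrite ?powR_ge0//.
      by apply: gt0_ltr_powR; rewrite ?nnegrE// (le_trans sa0)// ltW.
    by apply: gt0_ltr_powR; rewrite ?nnegrE// (le_trans sb0)// ltW.
have ia : (0 <= a^-1%:E :> \bar R)%E by rewrite lee_fin invr_ge0 ltW.
have ib : (0 <= b^-1%:E :> \bar R)%E by rewrite lee_fin invr_ge0 ltW.
have ic : (0 <= c^-1%:E :> \bar R)%E by rewrite lee_fin invr_ge0 ltW.
rewrite !ge0_integralZl// in key.
have if0 : (0 <= \int[lebesgue_measure]_x f x)%E by exact: integral_ge0.
have ig0 : (0 <= \int[lebesgue_measure]_x g x)%E by exact: integral_ge0.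
have := le_trans (poweRM_amgm l01 (mule_ge0 ia if0) (mule_ge0 ib ig0)) key.
rewrite !poweRM// muleACA !poweR_EFin -EFinM.
have -> : a^-1 `^ (1 - l) * b^-1 `^ l = c^-1.
  have inv (e r : R) : 0 < e -> e^-1 `^ r = (e `^ r)^-1.
    move=> e0; apply: (mulfI (lt0r_neq0 (powR_gt0 r e0))).
    rewrite -powRM ?invr_ge0 ?(ltW e0)// !mulfV ?powR1//; last exact: lt0r_neq0.
    by apply: lt0r_neq0; exact: powR_gt0.
  by rewrite /c !inv// invfM.
by rewrite (muleC c^-1%:E) (muleC c^-1%:E) lee_pmul2r// lte_fin invr_gt0.
Qed.

Lemma cvg_mine_nat (R : realType) (y : \bar R) :
  (0 <= y)%E -> mine y k%:R%:E @[k --> \oo] --> y.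
Proof.
case: y => [y| |]//.
- rewrite lee_fin => y0; apply: cvg_near_cst.
  exists (Num.truncn y).+1 => // k /= yk.
  apply/min_idPl; rewrite lee_fin.
  apply: le_trans (ltW (truncnS_gt y)) _; rewrite ler_nat//.
- move=> _; under eq_fun do rewrite min_r ?leey//.
  by apply/cvgeryP; exact: cvgr_idn.
Qed.

(** Truncation reduces to bounded functions. The two truncation heights are independent because
    [poweR_lim_le] takes one limit at a time. *)
Lemma prekopa_leindler1 (R : realType) (l : R)
    (f g h : measurableTypeR R -> \bar R) : 0 < l < 1 ->
  measurable_fun setT f -> measurable_fun setT g -> measurable_fun setT h ->
  (forall x, 0 <= f x)%E -> (forall x, 0 <= g x)%E -> (forall x, 0 <= h x)%E ->
  (forall x y : R, f x `^ (1 - l) * g y `^ l <= h ((1 - l) * x + l * y)%R)%E ->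
  ((\int[lebesgue_measure]_x f x) `^ (1 - l) *
   (\int[lebesgue_measure]_x g x) `^ l <= \int[lebesgue_measure]_x h x)%E.
Proof.
move=> l01 mf mg mh f0 g0 h0 fgh.
have /andP[l0 l1] := l01; have m0 : 0 < 1 - l by rewrite subr_gt0.
pose trunc (u : measurableTypeR R -> \bar R) (k : nat) x := mine (u x) k%:R%:E.
have mtrunc u k : measurable_fun setT u -> measurable_fun setT (trunc u k).
  by move=> mu; apply: measurable_mine.
have trunc0 u k : (forall x, 0 <= u x)%E -> (forall x, 0 <= trunc u k x)%E.
  by move=> u0 x; rewrite /trunc le_min u0 lee_fin ler0n.
have truncu u k x : (trunc u k x <= u x)%E by rewrite /trunc ge_min lexx.
have trunck u k x : (trunc u k x <= k%:R%:E)%E by rewrite /trunc ge_min lexx orbT.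
have ndtrunc u x : {homo (trunc u)^~ x : i j / (i <= j)%N >-> (i <= j)%E}.
  move=> i j ij; rewrite /trunc le_min !ge_min lexx /=.
  by rewrite lee_fin ler_nat ij orbT.
have cint u : measurable_fun setT u -> (forall x, 0 <= u x)%E ->
    (\int[lebesgue_measure]_x trunc u k x)%E @[k --> \oo] -->
    (\int[lebesgue_measure]_x u x)%E.
  move=> mu u0.
  have -> : (\int[lebesgue_measure]_x u x =
      \int[lebesgue_measure]_x limn ((trunc u)^~ x))%E.
    by apply: eq_integral => x _; apply/esym/cvg_lim => //; exact: cvg_mine_nat.
  apply: cvg_monotone_convergence => //.
  - by move=> k; exact: mtrunc.
  - by move=> k x _; exact: trunc0.
have bound i j : ((\int[lebesgue_measure]_x trunc f i x) `^ (1 - l) *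
   (\int[lebesgue_measure]_x trunc g j x) `^ l <= \int[lebesgue_measure]_x h x)%E.
  apply: (@prekopa_leindler1_bounded _ _ (maxn i j)%:R) => //.
  - exact: mtrunc.
  - exact: mtrunc.
  - move=> x; rewrite trunc0//= (le_trans (trunck _ _ _))// lee_fin ler_nat.
    exact: leq_maxl.
  - move=> x; rewrite trunc0//= (le_trans (trunck _ _ _))// lee_fin ler_nat.
    exact: leq_maxr.
  - move=> x y; apply: le_trans (fgh x y).
    by apply: lee_pmul; rewrite ?poweR_ge0// le_poweR ?trunc0// ltW.
have int0 u k : (forall x, 0 <= u x)%E -> (0 <= \int[lebesgue_measure]_x trunc u k x)%E.
  by move=> u0; apply: integral_ge0 => x _; exact: trunc0.
apply: (poweR_lim_le m0 _ (cint _ mf f0)); rewrite ?poweR_ge0//.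
  by move=> k; exact: int0.
move=> i; rewrite muleC.
apply: (poweR_lim_le l0 _ (cint _ mg g0)); rewrite ?poweR_ge0//.
  by move=> k; exact: int0.
by move=> j; rewrite muleC.
Qed.

(** * Slicing and induction on the dimension *)

Lemma scale_cons_rV (R : realType) (n : nat) (a b : R) (x : 'rV[R]_n) :
  a *: cons_rV (b, x) = cons_rV (a * b, a *: x).
Proof.
apply/rowP => i; rewrite mxE; have [j ->|->] := unliftP ord0 i.
  by rewrite !cons_rVS mxE.
by rewrite !cons_rV0.
Qed.

Lemma add_cons_rV (R : realType) (n : nat) (a b : R) (x y : 'rV[R]_n) :
  cons_rV (a, x) + cons_rV (b, y) = cons_rV (a + b, x + y).
Proof.
apply/rowP => i; rewrite mxE; have [j ->|->] := unliftP ord0 i.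
  by rewrite !cons_rVS mxE.
by rewrite !cons_rV0.
Qed.

Lemma measurable_cons_rV_section (R : realType) (n : nat)
    (f : 'rV[R]_n.+1 -> \bar R) (a : measurableTypeR R) :
  measurable_fun setT f -> measurable_fun setT (fun x => f (cons_rV (a, x))).
Proof.
move=> mf; apply: (measurableT_comp mf).
by apply: (measurableT_comp (@measurable_cons_rV R n)); exact: measurable_pair1.
Qed.

Lemma measurable_integral_cons_rV (R : realType) (n : nat)
    (f : 'rV[R]_n.+1 -> \bar R) :
  measurable_fun setT f -> (forall x, 0 <= f x)%E ->
  measurable_fun [set: measurableTypeR R]
    (fun a => (\int[lebesgue_rV R n]_x f (cons_rV (a, x)))%E).
Proof.
move=> mf f0.
apply: (@measurable_fun_fubini_tonelli_F _ _ _ _ _ (lebesgue_rV R n) (f \o cons_rV)) => //.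
  by apply: (measurableT_comp mf); exact: measurable_cons_rV.
by move=> x; exact: f0.
Qed.

Lemma integral_lebesgue_rVS (R : realType) (n : nat)
    (f : 'rV[R]_n.+1 -> \bar R) :
  measurable_fun setT f -> (forall x, 0 <= f x)%E ->
  (\int[lebesgue_rV R n.+1]_x f x =
   \int[lebesgue_measure]_a \int[lebesgue_rV R n]_x f (cons_rV (a, x)))%E.
Proof.
move=> mf f0.
have mc := @measurable_cons_rV R n.
rewrite -(fubini_tonelli1 (f \o cons_rV)) /=; last 2 first.
- exact: measurableT_comp.
- by move=> x; exact: f0.
have := @ge0_integral_pushforward _ _ _ _ R _ mc
  (lebesgue_measure \x lebesgue_rV R n)%E setT f measurableT mf.
rewrite preimage_setT => <-; last by move=> x _; exact: f0.
by apply: eq_measure_integral.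
Qed.

(** For fixed first coordinates [a] and [b], the slices of [f], [g] and the slice of [h] at the
    combined coordinate satisfy the hypothesis one dimension lower. Hence the slice integrals
    satisfy the one-dimensional hypothesis. *)
Theorem prekopa_leindler (R : realType) (n : nat) (l : R)
    (f g h : 'rV[R]_n -> \bar R) : 0 < l < 1 ->
  measurable_fun setT f -> measurable_fun setT g -> measurable_fun setT h ->
  (forall x, 0 <= f x)%E -> (forall x, 0 <= g x)%E -> (forall x, 0 <= h x)%E ->
  (forall x y, f x `^ (1 - l) * g y `^ l <= h ((1 - l) *: x + l *: y)%R)%E ->
  ((\int[lebesgue_rV R n]_x f x) `^ (1 - l) *
   (\int[lebesgue_rV R n]_x g x) `^ l <= \int[lebesgue_rV R n]_x h x)%E.
Proof.
move=> l01; elim: n f g h => [|n IH] f g h mf mg mh f0 g0 h0 fgh.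
  (* In dimension 0 the measure is a Dirac mass, and the claim is the hypothesis at its point. *)
  rewrite /lebesgue_rV /= !integral_dirac// !diracT !mul1e.
  by have := fgh 0 0; rewrite !scaler0 addr0.
rewrite !integral_lebesgue_rVS//.
apply: prekopa_leindler1 => //; do ?exact: measurable_integral_cons_rV.
- by move=> a; apply: integral_ge0 => x _; exact: f0.
- by move=> a; apply: integral_ge0 => x _; exact: g0.
- by move=> a; apply: integral_ge0 => x _; exact: h0.
move=> a b; apply: IH => //; do ?exact: measurable_cons_rV_section.
move=> x y; have := fgh (cons_rV (a, x)) (cons_rV (b, y)).
by rewrite !scale_cons_rV add_cons_rV.
Qed.

(** * Integrals under dilations *)

Lemma integral_scale1 (R : realType) (a : R) (f : measurableTypeR R -> \bar R) :
  0 < a -> measurable_fun setT f -> (forall x, 0 <= f x)%E ->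
  (\int[lebesgue_measure]_x f (a * x)%R =
   a^-1%:E * \int[lebesgue_measure]_x f x)%E.
Proof.
move=> a0 mf f0.
have mphi : measurable_fun [set: measurableTypeR R]
    (fun x : measurableTypeR R => a * x : measurableTypeR R).
  exact: mulrl_measurable.
have ia : 0 <= a^-1 by rewrite invr_ge0 ltW.
have := @ge0_integral_pushforward _ _ _ _ R _ mphi
  (@lebesgue_measure R) setT f measurableT mf.
rewrite preimage_setT => <-; last by move=> x _; exact: f0.
rewrite -(@ge0_integral_mscale _ _ _ lebesgue_measure _ measurableT (NngNum ia))//.
apply: eq_measure_integral => A mA _; rewrite /mscale /= /pushforward.
have := lebesgue_measure_affine 0 a0 mA.
by under eq_fun do rewrite addr0.
Qed.

Lemma measurable_scale_rV (R : realType) (n : nat) (a : R) :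
  measurable_fun [set: 'rV[R]_n] (fun x : 'rV[R]_n => a *: x).
Proof.
apply: measurable_fun_rVP => i.
apply: (eq_measurable_fun (fun x : 'rV[R]_n => a * x ord0 i : measurableTypeR R)).
  by move=> x _; rewrite mxE.
by apply: (measurableT_comp (mulrl_measurable a)); exact: measurable_coord_rV.
Qed.

Lemma integral_scale_rV (R : realType) (n : nat) (a : R) (f : 'rV[R]_n -> \bar R) :
  0 < a -> measurable_fun setT f -> (forall x, 0 <= f x)%E ->
  (\int[lebesgue_rV R n]_x f (a *: x)%R =
   (a ^- n)%:E * \int[lebesgue_rV R n]_x f x)%E.
Proof.
move=> a0; elim: n f => [|n IH] f mf f0.
  rewrite expr0 invr1 mul1e; apply: eq_integral => x _.
  by rewrite (_ : a *: x = x)//; apply/rowP; case.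
have ms := @measurable_scale_rV R.
rewrite !integral_lebesgue_rVS//; last exact: (measurableT_comp mf (ms _ _)).
under eq_integral => b _.
  under eq_integral do rewrite scale_cons_rV.
  rewrite (IH (fun x => f (cons_rV (a * b, x))))//; last exact: measurable_cons_rV_section.
  over.
rewrite /= (@integral_scale1 _ a (fun b => (a ^- n)%:E * \int[lebesgue_rV R n]_x f (cons_rV (b, x)))%E)//.
- rewrite ge0_integralZl//.
  + by rewrite muleA -EFinM exprS invfM.
  + exact: measurable_integral_cons_rV.
  + by move=> b _; apply: integral_ge0 => x _; exact: f0.
  + by rewrite lee_fin invr_ge0 exprn_ge0// ltW.
- by apply: measurable_funeM; exact: measurable_integral_cons_rV.
- move=> b; rewrite mule_ge0//; first by rewrite lee_fin invr_ge0 exprn_ge0// ltW.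
  by apply: integral_ge0 => x _; exact: f0.
Qed.

(** * Scalar inequalities *)

(** The graph of [c ^ q] lies above its tangent at 1. This is read off from Young's inequality for
    [c] and 1; [q = 1] is separate, having no finite conjugate exponent. *)
Lemma bernoulli_powR (R : realType) (q c : R) : 1 <= q -> 0 < c ->
  1 - c `^ q <= q * (1 - c).
Proof.
move=> q1 c0.
have q0 : 0 < q by exact: lt_le_trans q1.
have [->|qn1] := eqVneq q 1; first by rewrite powRr1 ?mul1r// ltW.
have {}q1 : 1 < q by rewrite lt_neqAle eq_sym qn1.
have := @conjugate_powR R c 1 q (q / (q - 1)) (ltW c0) ler01 q0.
have qq : q^-1 + (q / (q - 1))^-1 = 1.
  by rewrite invf_div; field; rewrite gt_eqF.
rewrite divr_gt0 ?subr_gt0// => /(_ isT qq).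
rewrite powR1 mulr1 mul1r invf_div => H.
have : q * c <= q * (c `^ q / q + (q - 1) / q) by rewrite ler_pM2l.
have -> : q * (c `^ q / q + (q - 1) / q) = c `^ q + q - 1.
  by field; rewrite gt_eqF.
lra.
Qed.

Section log_comparison.
Context {R : realType}.
Variables (m l q : R).
Hypotheses (m0 : 0 < m) (l0 : 0 < l) (ml : m + l = 1) (q1 : 1 < q).

(* [ln_mean_comparison] at [c = e^{-u}] reads [psi 0 <= psi u]. *)
Let psi (u : R) : R := (q - 1) * m * u + l / q * ln (1 - m * expR (- (q * u)))
  - q * l * ln (1 - m * expR (- u)).

Let dpsi (u : R) : R := (q - 1) * m
  + l / q * ((1 - m * expR (- (q * u)))^-1 * (m * (q * expR (- (q * u)))))
  - q * l * ((1 - m * expR (- u))^-1 * (m * expR (- u))).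

Let pos (u : R) : 0 <= u -> 0 < 1 - m * expR (- u).
Proof.
move=> u0; have : expR (- u) <= 1 by rewrite -expR0 ler_expR lerNl oppr0.
move=> e1; have : m * expR (- u) <= m by rewrite ler_piMr// ltW.
by move: ml l0; lra.
Qed.

Let dlog (k u : R) : 0 < 1 - m * expR (- (k * u)) ->
  is_derive u 1 (fun u : R => ln (1 - m * expR (- (k * u))))
    ((1 - m * expR (- (k * u)))^-1 * (m * (k * expR (- (k * u))))).
Proof.
move=> p.
have d1 : is_derive u 1 (fun u : R => - (k * u)) (- k).
  have : is_derive u 1 (fun u : R => - (k *: (u : R^o))) (- (k *: 1)).
    exact: is_deriveN.
  by rewrite /GRing.scale /= mulr1.
have d2 : is_derive u 1 (fun u : R => expR (- (k * u))) (expR (- (k * u)) * - k).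
  exact: (@is_derive1_comp _ expR (fun u : R => - (k * u)) u _ _ (is_derive_expR _) d1).
have d3 : is_derive u 1 (fun u : R => 1 - m * expR (- (k * u)))
    (m * (k * expR (- (k * u)))).
  have := @is_deriveB R R^o R^o (cst (1 : R^o)) (fun u : R => m *: (expR (- (k * u)) : R^o)) u 1
     _ _ (is_derive_cst (1 : R^o) u 1) (is_deriveZ _ d2).
  set e := (X in is_derive _ _ _ X).
  have -> : e = m * (k * expR (- (k * u))).
    by rewrite /e /GRing.scale /= sub0r -mulrN; congr (_ * _); rewrite mulrN opprK mulrC.
  exact.
have d4 : is_derive (1 - m * expR (- (k * u))) 1 (@ln R) (1 - m * expR (- (k * u)))^-1.
  exact: is_derive1_ln.
exact: (@is_derive1_comp _ (@ln R) (fun u : R => 1 - m * expR (- (k * u))) u _ _ d4 d3).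
Qed.

Let dpsiE (u : R) : 0 <= u -> is_derive u 1 psi (dpsi u).
Proof.
move=> u0.
have qu0 : 0 <= q * u by rewrite mulr_ge0// ltW// (lt_trans ltr01).
have d1 := dlog (pos qu0).
have d2 : is_derive u 1 (fun u : R => ln (1 - m * expR (- u)))
    ((1 - m * expR (- u))^-1 * (m * expR (- u))).
  have := @dlog 1 u; rewrite !mul1r => /(_ (pos u0)).
  by under eq_fun do rewrite mul1r.
have := is_deriveB (is_deriveD (is_deriveZ ((q - 1) * m) (is_derive_id u (1 : R^o)))
  (is_deriveZ (l / q) d1)) (is_deriveZ (q * l) d2).
set e := (X in is_derive _ _ _ X).
have -> : e = dpsi u by rewrite /e /dpsi /GRing.scale /= mulr1.
exact.
Qed.

(** With [C = e^{-u}] and [D = C^q], the derivative equals [m] times the difference of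
    [q (1 - C) / (1 - m C)] and [(1 - D) / (1 - m D)]. Bernoulli compares the numerators, and
    [D <= C] compares the denominators. *)
Let dpsi_ge0 (u : R) : 0 <= u -> 0 <= dpsi u.
Proof.
move=> u0.
have q0 : 0 < q by rewrite (lt_trans ltr01).
have qu0 : 0 <= q * u by rewrite mulr_ge0// ltW// (lt_trans ltr01).
rewrite /dpsi.
have p1 := pos u0; have p2 := pos qu0.
have Cq : expR (- (q * u)) = expR (- u) `^ q.
  by rewrite -mulrN mulrC expRM.
rewrite Cq in p2 *.
have C0 : 0 < expR (- u) by exact: expR_gt0.
have C1 : expR (- u) <= 1 by rewrite -expR0 ler_expR lerNl oppr0.
move: (expR (- u)) C0 C1 p1 p2 => C C0 C1 p1 p2.
have B := bernoulli_powR (ltW q1) C0.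
have CqC : C `^ q <= C by rewrite ge1r_powR ?C0// ltW.
set D := C `^ q in B CqC p2 *.
have key : (1 - D) / (1 - m * D) <= q * ((1 - C) / (1 - m * C)).
  apply: (@le_trans _ _ ((1 - D) / (1 - m * C))).
    rewrite ler_wpM2l//; first by rewrite subr_ge0 (le_trans CqC).
    by rewrite lef_pV2 ?posrE// lerD2l lerN2 ler_pM2l.
  by rewrite mulrA ler_pM2r ?invr_gt0.
have e1 : l / q * ((1 - m * D)^-1 * (m * (q * D))) = m * (1 - (1 - D) / (1 - m * D)).
  have -> : l = 1 - m by move: ml; lra.
  by field; rewrite (gt_eqF q0) (gt_eqF p2).
have e2 : q * l * ((1 - m * C)^-1 * (m * C)) = m * (q - q * ((1 - C) / (1 - m * C))).
  have -> : l = 1 - m by move: ml; lra.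
  by field; rewrite (gt_eqF p1).
rewrite e1 e2.
have -> : (q - 1) * m + m * (1 - (1 - D) / (1 - m * D)) -
    m * (q - q * ((1 - C) / (1 - m * C))) =
  m * (q * ((1 - C) / (1 - m * C)) - (1 - D) / (1 - m * D)) by ring.
by rewrite mulr_ge0 ?subr_ge0// ltW.
Qed.

(** This is the logarithm of the last bound in [scaling_pair_exists] for [a = c]: the arguments of
    the logarithms with quotients are [d] and [b^q]. At [c = 1] both sides vanish. *)
Lemma ln_mean_comparison (c : R) : 0 < c <= 1 ->
  q * (m * ln c + l * ln ((1 - m * c) / l)) <=
  m * ln c + l / q * ln ((1 - m * c `^ q) / l).
Proof.
move=> /andP[c0 c1].
have q0 : 0 < q by rewrite (lt_trans ltr01).
pose u := - ln c.
have u0 : 0 <= u by rewrite oppr_ge0 ln_le0.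
have cE : c = expR (- u) by rewrite opprK lnK ?posrE.
have qu0 : 0 <= q * u by rewrite mulr_ge0// ltW// (lt_trans ltr01).
have cqE : c `^ q = expR (- (q * u)) by rewrite -mulrN mulrC expRM -cE.
have : psi 0 <= psi u.
  apply: (@ger0_derive1_ndecry R psi 0 _ _ _ 0 u (lexx 0) u0).
  - move=> x; rewrite in_itv /= andbT => x0.
    by have [] := dpsiE (ltW x0).
  - move=> x; rewrite in_itv /= andbT => x0.
    by rewrite derive1E; have [_ ->] := dpsiE (ltW x0); exact: dpsi_ge0 (ltW x0).
  - apply: derivable_within_continuous => x; rewrite in_itv /= andbT => x0.
    by have [] := dpsiE x0.
have p1 := pos u0; have p2 := pos qu0.
rewrite !ln_div ?posrE ?cqE//; last by rewrite cE.
rewrite /psi !mulr0 !oppr0 !expR0 !mulr1 -cE add0r.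
have -> : 1 - m = l by move: ml; lra.
have -> : ln c = - u by rewrite opprK.
move: (l / q) (ln l) (ln (1 - m * c)) (ln _) => r L1 L2 L3; lra.
Qed.

End log_comparison.

Lemma ln_powRM (R : realType) (r s x y : R) : 0 < x -> 0 < y ->
  ln (x `^ r * y `^ s) = r * ln x + s * ln y.
Proof.
move=> x0 y0; have := @lnM R (x `^ r) (y `^ s).
by rewrite !posrE !powR_gt0// => ->; rewrite ?ln_powR.
Qed.

(** The choice [a = c^q], [b = d^q] would give equality in the last bound, but the larger of [c] and
    [d] may exceed 1, and its power then exceeds it. Instead the smaller one is kept, say [a = c],
    and the constraint determines [b]. *)
Lemma scaling_pair_exists (R : realType) (m l q c d : R) :
  0 < m -> 0 < l -> m + l = 1 -> 1 < q -> 0 < c -> 0 < d -> m * c + l * d = 1 ->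
  exists a b : R, [/\ 0 < a <= c, 0 < b <= d, m * a `^ q + l * b `^ q = 1 &
    (c `^ q) `^ m * (d `^ q) `^ l <= a `^ m * b `^ l].
Proof.
move=> m0 l0 ml q1.
wlog cd : m l c d m0 l0 ml / c <= d => [hwlog c0 d0 cd1|c0 d0 cd1].
  have [|/ltW] := leP c d; first by move=> ?; exact: hwlog.
  move=> dc; have [| | | | | | |b [a [b1 a1 e1 e2]]] := hwlog l m d c => //.
  - by rewrite addrC.
  - by rewrite addrC.
  - exists a, b; split => //; first by rewrite addrC.
    by rewrite mulrC [leRHS]mulrC.
have c1 : c <= 1.
  rewrite -cd1 -[leLHS]mul1r -ml mulrDl lerD2l ler_pM2l//.
have q0 : 0 < q by rewrite (lt_trans ltr01).
have m1 : m < 1 by move: ml l0; lra.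
have cq1 : c `^ q <= 1.
  suff : c `^ q <= 1 `^ q by rewrite powR1.
  by apply: ge0_ler_powR => //; rewrite ?nnegrE ltW.
have mcq : m * c `^ q < 1.
  by apply: le_lt_trans m1; rewrite ler_piMr// ltW.
(* [X] is [b^q], as forced by the constraint with [a = c]; the existential keeps it opaque. *)
have [X XE] : exists X, X = (1 - m * c `^ q) / l by eexists.
have X0 : 0 < X by rewrite XE divr_gt0// subr_gt0.
have dE : d = (1 - m * c) / l by rewrite -cd1 addrAC subrr add0r mulrC mulKf// gt_eqF.
have XK : (X `^ q^-1) `^ q = X by rewrite -powRrM mulVf ?gt_eqF// powRr1// ltW.
have c01 : 0 < c <= 1 by rewrite c0.
exists c, (X `^ q^-1); split.
- by rewrite c0 lexx.
- rewrite powR_gt0//=.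
  have : X <= d `^ q.
    rewrite XE ler_pdivrMr//.
    (* Bernoulli at [c] and at [d], with weights [m] and [l]. The right-hand side is 0 because
       [m c + l d = 1], so [m c^q + l d^q >= 1]. *)
    have : m * (1 - c `^ q) + l * (1 - d `^ q) <= m * (q * (1 - c)) + l * (q * (1 - d)).
      by rewrite lerD// ler_pM2l// bernoulli_powR// ltW.
    have -> : m * (q * (1 - c)) + l * (q * (1 - d)) = q * ((m + l) - (m * c + l * d)).
      by ring.
    by rewrite cd1 ml; move: ml; lra.
  rewrite -{1}XK; have [//|dX] := leP (X `^ q^-1) d.
  rewrite leNgt => /negP[]; apply: gt0_ltr_powR => //; rewrite nnegrE ?powR_ge0//.
  exact: ltW.
- by rewrite XK XE; field; rewrite gt_eqF.
- have X1 : 0 < X `^ q^-1 by rewrite powR_gt0.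
  have cq0 : 0 < c `^ q by rewrite powR_gt0.
  have dq0 : 0 < d `^ q by rewrite powR_gt0.
  rewrite -ler_ln; [|by rewrite posrE mulr_gt0// powR_gt0..].
  rewrite [leLHS](ln_powRM m l cq0 dq0) [leRHS](ln_powRM m l c0 X1).
  rewrite (ln_powR c) (ln_powR d) (ln_powR X).
  rewrite [in ln d]dE; have := ln_mean_comparison m0 l0 ml q1 c01.
  rewrite -XE; move: (ln c) (ln X) (ln _) => L1 L2 L3; lra.
Qed.

Lemma powRM_amgm (R : realType) (m l x y : R) : 0 < m -> 0 < l -> m + l = 1 ->
  0 <= x -> 0 <= y -> x `^ m * y `^ l <= m * x + l * y.
Proof.
move=> m0 l0 ml x0 y0; have -> : m = 1 - l by rewrite -ml addrK.
have l01 : 0 < l < 1 by rewrite l0 /= -ml ltrDr.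
rewrite -lee_fin; have := @poweRM_amgm R l x%:E y%:E l01.
by rewrite !lee_fin; apply.
Qed.

(** The two factors are [p]-th roots of [c x^p] and [d y^p], whose arithmetic mean with weights [m],
    [l] is [(1 - t) x^p + t y^p] for every splitting of [1 - t] and [t]. *)
Lemma power_mean_ge (R : realType) (p t m l c d x y : R) :
  0 < t < 1 -> 0 < p -> 0 < m -> 0 < l -> m + l = 1 -> m * c = 1 - t ->
  l * d = t -> 0 <= x -> 0 <= y ->
  (c `^ p^-1 * x) `^ m * (d `^ p^-1 * y) `^ l <= power_mean p%:E t x y.
Proof.
move=> /andP[t0 t1] p0 m0 l0 ml mc ld; rewrite le_eqVlt => /orP[/eqP <- _|x0].
  by rewrite mulr0 powR0 ?gt_eqF// mul0r /power_mean mul0r ltxx.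
rewrite le_eqVlt => /orP[/eqP <-|y0].
  by rewrite !mulr0 [X in _ * X]powR0 ?gt_eqF// mulr0 /power_mean mulr0 ltxx.
rewrite /power_mean mulr_gt0//= gt_eqF//.
have c0 : 0 < c by rewrite -(pmulr_rgt0 _ m0) mc subr_gt0.
have d0 : 0 < d by rewrite -(pmulr_rgt0 _ l0) ld.
have [X XE] : exists X, X = c * x `^ p by eexists.
have [Y YE] : exists Y, Y = d * y `^ p by eexists.
have X0 : 0 <= X by rewrite XE mulr_ge0 ?powR_ge0// ltW.
have Y0 : 0 <= Y by rewrite YE mulr_ge0 ?powR_ge0// ltW.
have root (w z : R) : 0 < w -> 0 < z -> w `^ p^-1 * z = (w * z `^ p) `^ p^-1.
  move=> w0 z0; rewrite powRM ?powR_ge0 ?(ltW w0)// -powRrM mulfV ?gt_eqF//.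
  by rewrite powRr1// ltW.
rewrite !root// -XE -YE.
rewrite (powRAC X p^-1 m) (powRAC Y p^-1 l) -powRM ?powR_ge0//.
have := powRM_amgm m0 l0 ml X0 Y0.
have -> : m * X + l * Y = (1 - t) * x `^ p + t * y `^ p.
  by rewrite XE YE !mulrA mc ld.
apply: ge0_ler_powR; rewrite ?invr_ge0 ?(ltW p0) ?nnegrE ?mulr_ge0 ?powR_ge0//.
by rewrite addr_ge0// mulr_ge0 ?powR_ge0// ?subr_ge0 ltW.
Qed.

(** At infinite [p] the factors [c^{1/p}] and [d^{1/p}] become 1, and a geometric mean with any
    weights is at most the maximum. *)
Lemma power_mean_infty_ge (R : realType) (t m l x y : R) :
  0 < m -> 0 < l -> m + l = 1 -> 0 <= x -> 0 <= y ->
  x `^ m * y `^ l <= power_mean +oo%E t x y.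
Proof.
move=> m0 l0 ml; rewrite le_eqVlt => /orP[/eqP <- _|x0].
  by rewrite powR0 ?gt_eqF// mul0r /power_mean mul0r ltxx.
rewrite le_eqVlt => /orP[/eqP <-|y0].
  by rewrite [X in _ * X]powR0 ?gt_eqF// mulr0 /power_mean mulr0 ltxx.
rewrite /power_mean mulr_gt0//.
apply: le_trans (powRM_amgm m0 l0 ml (ltW x0) (ltW y0)) _.
have -> : Num.max x y = m * Num.max x y + l * Num.max x y by rewrite -mulrDl ml mul1r.
by apply: lerD; rewrite ler_pM2l// le_max lexx ?orbT.
Qed.

(** These weights make [c^{1/r} I] and [d^{1/r} J] coincide, so a geometric mean of the two loses
    nothing: this is the equality case of AM-GM. *)
Lemma power_mean_weights (R : realType) (t r I J : R) :
  0 < t < 1 -> 0 < r -> 0 < I -> 0 < J ->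
  let s := ((1 - t) * I `^ r + t * J `^ r) `^ r^-1 in
  exists m l c d : R, [/\ [/\ 0 < m, 0 < l, 0 < c & 0 < d],
    [/\ m + l = 1, m * c = 1 - t & l * d = t],
    c `^ r^-1 * I = s & d `^ r^-1 * J = s].
Proof.
move=> /andP[t0 t1] r0 I0 J0 s.
have t1' : 0 < 1 - t by rewrite subr_gt0.
have Ir : 0 < I `^ r by rewrite powR_gt0.
have Jr : 0 < J `^ r by rewrite powR_gt0.
have [S SE] : exists S, S = (1 - t) * I `^ r + t * J `^ r by eexists.
have S0 : 0 < S by rewrite SE addr_gt0// mulr_gt0.
have cancel (z : R) : 0 < z -> (S / z `^ r) `^ r^-1 * z = S `^ r^-1.
  move=> z0; have zr : 0 < z `^ r by rewrite powR_gt0.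
  have {2}-> : z = (z `^ r) `^ r^-1 by rewrite -powRrM mulfV ?gt_eqF// powRr1// ltW.
  rewrite -powRM ?divfK ?gt_eqF//; last exact: ltW.
  by rewrite divr_ge0// ltW.
exists ((1 - t) * I `^ r / S), (t * J `^ r / S), (S / I `^ r), (S / J `^ r).
split; rewrite ?/s -?SE ?cancel//.
  by split; rewrite divr_gt0// mulr_gt0.
split.
- by rewrite -mulrDl -SE mulfV// gt_eqF.
- by field; rewrite !gt_eqF.
- by field; rewrite !gt_eqF.
Qed.

(** Here [k] stands for [1/p]. The exponent [q n] splits off [n]-th powers of [c^q] and [d^q], which
    [a] and [b] may replace once they are joined in a geometric mean. *)
Lemma weighted_mean_le (R : realType) (n : nat) (m l q k a b c d I J s : R) :
  0 < a -> 0 < b -> 0 < c -> 0 < d -> 0 < I -> 0 < J -> m + l = 1 ->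
  (c `^ q) `^ m * (d `^ q) `^ l <= a `^ m * b `^ l ->
  c `^ (k + q * n%:R) * I = s -> d `^ (k + q * n%:R) * J = s ->
  s <= (a ^+ n * (c `^ k * I)) `^ m * (b ^+ n * (d `^ k * J)) `^ l.
Proof.
move=> a0 b0 c0 d0 I0 J0 ml abcd cI dJ.
have s0 : 0 < s by rewrite -cI mulr_gt0// powR_gt0.
have split_pow (w z : R) : 0 < w ->
    w `^ (k + q * n%:R) * z = (w `^ q) ^+ n * (w `^ k * z).
  move=> w0; rewrite powRD ?(gt_eqF w0) ?implybT// powRrM powR_mulrn ?powR_ge0//.
  by rewrite mulrAC mulrC.
have [X XE] : exists X, X = c `^ k * I by eexists.
have [Y YE] : exists Y, Y = d `^ k * J by eexists.
have X0 : 0 <= X by rewrite XE mulr_ge0 ?powR_ge0// ltW.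
have Y0 : 0 <= Y by rewrite YE mulr_ge0 ?powR_ge0// ltW.
move: cI dJ; rewrite !split_pow// -XE -YE => cX dY.
have expand (u v : R) : 0 <= u -> 0 <= v ->
    (u ^+ n * X) `^ m * (v ^+ n * Y) `^ l =
    (u `^ m * v `^ l) ^+ n * (X `^ m * Y `^ l).
  move=> u0 v0; rewrite (powRM m (exprn_ge0 n u0) X0) (powRM l (exprn_ge0 n v0) Y0).
  rewrite mulrACA; congr (_ * _); rewrite exprMn.
  have pn (w r : R) : 0 <= w -> (w ^+ n) `^ r = (w `^ r) ^+ n.
    by move=> w0; rewrite -(powR_mulrn n w0) -(powR_mulrn n (powR_ge0 w r)) powRAC.
  by rewrite (pn u m u0) (pn v l v0).
(* The first factor is then expressed through [c] and [I], the second through [d] and [J]. *)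
have -> : s = s `^ m * s `^ l.
  by rewrite -powRD ml ?powRr1 ?ltW// oner_eq0.
rewrite -{1}cX -dY.
rewrite (expand _ _ (powR_ge0 c q) (powR_ge0 d q)) (expand _ _ (ltW a0) (ltW b0)).
rewrite ler_wpM2r ?mulr_ge0 ?powR_ge0//.
by rewrite lerXn2r ?nnegrE ?mulr_ge0 ?powR_ge0.
Qed.

(** * Homogeneous convex functions *)

Section homogeneous_convex.
Context {R : realType} {n : nat}.
Variables (beta : R) (V : 'rV[R]_n -> R).
Hypotheses (beta1 : 1 < beta) (Vconv : convex_function [set: 'rV[R]_n] V)
  (Vhom : homogeneous_fun beta V).

Let beta0 : 0 < beta. Proof. exact: lt_trans beta1. Qed.

Lemma convex_function_rV (x y : 'rV[R]_n) (s r : R) :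
  0 <= s -> 0 <= r -> s + r = 1 -> V (s *: x + r *: y) <= s * V x + r * V y.
Proof.
move=> s0 r0 sr.
have s1 : s <= 1 by rewrite -sr lerDl.
have rE : r = 1 - s by rewrite -sr addrAC subrr add0r.
have := @Vconv (Itv01 s0 s1) x y.
by rewrite !inE => /(_ Logic.I Logic.I); rewrite rE.
Qed.

(** Homogeneity concerns positive factors only, so the origin is treated by doubling:
    [V 0 = 2^beta V 0]. *)
Lemma homogeneous_fun0 : V 0 = 0.
Proof.
have := @Vhom 0 2; rewrite scaler0 => /(_ (ltr0n _ _)) V0.
have : (2 `^ beta - 1) * V 0 = 0 by rewrite mulrBl mul1r -V0 subrr.
move=> /eqP; rewrite mulf_eq0 => /orP[|/eqP//].
rewrite subr_eq0 => /eqP two1.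
have := @gt0_ltr_powR R _ beta0 1 2; rewrite !nnegrE => /(_ ler01 (ler0n _ _)).
by rewrite powR1 two1 ltxx => /(_ (ltr1n _ _)).
Qed.

(** Since [x] is the midpoint of 0 and [2 x], convexity gives [V x <= 2^(beta - 1) V x], with a
    factor above 1. *)
Lemma homogeneous_convex_ge0 x : 0 <= V x.
Proof.
have h0 : 0 <= 2^-1 :> R by rewrite invr_ge0.
have h1 : 2^-1 + 2^-1 = 1 :> R by field.
have := @convex_function_rV (2 *: x) 0 2^-1 2^-1 h0 h0 h1.
rewrite scaler0 addr0 scalerA mulVf ?pnatr_eq0// scale1r.
rewrite homogeneous_fun0 mulr0 addr0 Vhom ?ltr0n// mulrA.
have -> : 2^-1 * 2 `^ beta = 2 `^ (beta - 1) :> R.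
  rewrite powRD; last by rewrite pnatr_eq0 implybT.
  by rewrite powR_inv1 ?ler0n// mulrC.
have t1 : 1 < 2 `^ (beta - 1) :> R.
  have := @gt0_ltr_powR R (beta - 1) _ 1 2; rewrite subr_gt0 => /(_ beta1).
  by rewrite !nnegrE powR1 => /(_ ler01 (ler0n _ _) (ltr1n _ _)).
move=> V1; rewrite leNgt; apply/negP => V0.
by move: V1; rewrite leNgt gtr_nMl// t1.
Qed.

Local Notation q := (beta / (beta - 1)).

(* The weights [m a^q] and [l b^q] turn [m x + l y] into a convex combination
   of multiples of [x] and [y]; [q] is conjugate to [beta], so homogeneity
   turns the resulting bound into the one below. *)
Lemma homogeneous_convex_comb (m l a b : R) (x y : 'rV[R]_n) :
  0 < m -> 0 < l -> 0 < a -> 0 < b -> m * a `^ q + l * b `^ q = 1 ->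
  V (m *: x + l *: y) <= m * V (a^-1 *: x) + l * V (b^-1 *: y).
Proof.
move=> m0 l0 a0 b0 mab.
have E (k c : R) (z : 'rV[R]_n) : 0 < c ->
    k *: z = (k * c `^ q) *: ((c `^ q)^-1 *: z).
  move=> c0; rewrite scalerA -mulrA mulfV ?mulr1// gt_eqF// powR_gt0//.
have W (k c : R) (z : 'rV[R]_n) : 0 < c ->
    (k * c `^ q) * V ((c `^ q)^-1 *: z) = k * V (c^-1 *: z).
  move=> c0; rewrite !Vhom ?invr_gt0 ?powR_gt0// -mulrA; congr (_ * _).
  rewrite mulrA; congr (_ * _).
  rewrite -powRN -(powR_inv1 (ltW c0)) -!powRrM -powRD; last first.
    by rewrite (gt_eqF c0) implybT.
  by congr (_ `^ _); field; rewrite subr_eq0 gt_eqF.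
rewrite {1}(E m a x a0) {1}(E l b y b0).
apply: le_trans (convex_function_rV _ _ _ _ mab) _.
- by rewrite mulr_ge0 ?powR_ge0// ltW.
- by rewrite mulr_ge0 ?powR_ge0// ltW.
- by rewrite !W.
Qed.

(** The Minkowski gauge of the convex set where [V <= 1]. It is positively homogeneous of degree 1
    and subadditive, hence Lipschitz, which yields the Borel measurability of [V]. *)
Let W (x : 'rV[R]_n) := V x `^ beta^-1.

Let W_ge0 x : 0 <= W x. Proof. exact: powR_ge0. Qed.

Let WK x : W x `^ beta = V x.
Proof.
by rewrite -powRrM mulVf ?gt_eqF// powRr1// homogeneous_convex_ge0.
Qed.

Let Wle x (c : R) : 0 <= c -> V x <= c `^ beta -> W x <= c.
Proof.
move=> c0 Vc; have -> : c = (c `^ beta) `^ beta^-1.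
  by rewrite -powRrM mulfV ?gt_eqF// powRr1.
apply: ge0_ler_powR; rewrite ?nnegrE ?powR_ge0 ?homogeneous_convex_ge0//.
by rewrite invr_ge0 ltW.
Qed.

Let WZ (c : R) x : 0 < c -> W (c *: x) = c * W x.
Proof.
move=> c0; rewrite /W Vhom// powRM ?powR_ge0 ?homogeneous_convex_ge0//.
by rewrite -powRrM mulfV ?gt_eqF// powRr1// ltW.
Qed.

(** The triangle inequality for a gauge: [(x + y) / (A + B)] is a convex combination of the points
    [x / A] and [y / B] of the unit ball. The [e / 2] keeps [A] and [B] positive where [W]
    vanishes. *)
Let WD x y : W (x + y) <= W x + W y.
Proof.
apply/ler_addgt0Pr => e e0.
pose A := W x + e / 2; pose B := W y + e / 2.
have e20 : 0 < e / 2 by rewrite divr_gt0.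
have A0 : 0 < A by rewrite ltr_wpDl.
have B0 : 0 < B by rewrite ltr_wpDl.
have AB0 : 0 < A + B by rewrite addr_gt0.
have -> : W x + W y + e = A + B by rewrite /A /B; field.
apply: Wle; first exact: ltW.
have unit_ball z (C : R) : 0 < C -> W z <= C -> V (C^-1 *: z) <= 1.
  move=> C0 zC; rewrite -WK WZ ?invr_gt0//.
  suff : (C^-1 * W z) `^ beta <= 1 `^ beta by rewrite powR1.
  apply: ge0_ler_powR; rewrite ?nnegrE ?(ltW beta0) ?mulr_ge0 ?invr_ge0 ?(ltW C0)//.
  by rewrite mulrC ler_pdivrMr// mul1r.
have -> : x + y = (A + B) *: ((A / (A + B)) *: (A^-1 *: x) + (B / (A + B)) *: (B^-1 *: y)).
  rewrite scalerDr !scalerA.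
  have -> : (A + B) * (A / (A + B)) / A = 1 by field; rewrite !gt_eqF.
  have -> : (A + B) * (B / (A + B)) / B = 1 by field; rewrite !gt_eqF.
  by rewrite !scale1r.
rewrite Vhom// ler_piMr ?powR_ge0//.
have AB1 : A / (A + B) + B / (A + B) = 1 by rewrite -mulrDl mulfV// gt_eqF.
apply: le_trans (convex_function_rV _ _ _ _ AB1) _.
- by rewrite divr_ge0// ltW.
- by rewrite divr_ge0// ltW.
rewrite -[leRHS]AB1; apply: lerD; rewrite ler_piMr ?divr_ge0 ?(ltW A0) ?(ltW B0) ?(ltW AB0)//.
  by apply: unit_ball => //; rewrite lerDl ltW.
by apply: unit_ball => //; rewrite lerDl ltW.
Qed.

Let W0 : W 0 = 0.
Proof. by rewrite /W homogeneous_fun0 powR0// invr_eq0 gt_eqF. Qed.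

(** Both signs occur because [W] need not be even. *)
Let C : R := \sum_(i < n) (W (delta_mx 0 i) + W (- delta_mx 0 i)).

Let W_norm1 x : W x <= C * \sum_(i < n) `|x ord0 i|.
Proof.
have -> : W x = W (\sum_(i < n) x ord0 i *: delta_mx 0 i).
  by rewrite {1}(row_sum_delta x).
apply: (@le_trans _ _ (\sum_(i < n) W (x ord0 i *: delta_mx 0 i))).
  elim/big_rec2: _ => [|i a b _ ab]; first by rewrite W0.
  by apply: le_trans (WD _ _) _; rewrite lerD2l.
rewrite mulr_sumr; apply: ler_sum => i _.
have dC : W (delta_mx 0 i) + W (- delta_mx 0 i) <= C.
  rewrite /C (bigD1 i)//= lerDl; apply: sumr_ge0 => j _; exact: addr_ge0.
have [x0|x0|x0] := ltgtP (x ord0 i) 0.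
- have -> : x ord0 i *: delta_mx 0 i = `|x ord0 i| *: (- delta_mx 0 i : 'rV[R]_n).
    by rewrite ltr0_norm// scalerN scaleNr opprK.
  rewrite WZ ?normr_gt0 ?lt_eqF// mulrC ler_wpM2r//.
  by apply: le_trans dC; rewrite lerDr.
- rewrite gtr0_norm// WZ// mulrC ler_wpM2r//; first exact: ltW.
  by apply: le_trans dC; rewrite lerDl.
- by rewrite x0 scale0r W0 normr0 mulr0.
Qed.

Let W_lipschitz x y : W x <= W y + C * \sum_(i < n) `|x ord0 i - y ord0 i|.
Proof.
rewrite -{1}(subrK y x) addrC; apply: le_trans (WD _ _) _; rewrite lerD2l.
apply: le_trans (W_norm1 _) _; under eq_bigr do rewrite !mxE.
exact: lexx.
Qed.

(** The sigma-algebra is generated by coordinates, so a sublevel set is written as a countable union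
    of rational [l^1] balls, namely those on which the Lipschitz bound from the centre stays below
    the level. *)
Lemma measurable_lipschitz_rV (u : 'rV[R]_n -> R) (K : R) :
  (forall x y, u x <= u y + K * \sum_(i < n) `|x ord0 i - y ord0 i|) ->
  measurable_fun [set: 'rV[R]_n] u.
Proof.
wlog K0 : K / 0 <= K => [hwlog uK|uK].
  apply: (hwlog `|K|) => // x y; apply: le_trans (uK x y) _.
  by rewrite lerD2l ler_wpM2r ?ler_norm// sumr_ge0.
pose dist (x y : 'rV[R]_n) := \sum_(i < n) `|x ord0 i - y ord0 i|.
have mdist y : measurable_fun [set: 'rV[R]_n] (dist^~ y).
  apply: measurable_sum => i.
  have mB : measurable_fun [set: 'rV[R]_n] (fun x => x ord0 i - y ord0 i : measurableTypeR R).
    exact: (measurable_realfun.measurable_funB (measurable_coord_rV i) (measurable_cst _)).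
  exact: (measurableT_comp (@normr_measurable R setT) mB).
move=> mT; apply: (measurability _ (RGenInftyO.measurableE R)) => //.
move=> _ [_ [r ->] <-].
pose pt (z : 'rV[rat]_n) : 'rV[R]_n := map_mx (@ratr R) z.
pose F (zd : 'rV[rat]_n * rat) : set 'rV[R]_n :=
  if u (pt zd.1) + K * ratr zd.2 < r then [set x | dist x (pt zd.1) < ratr zd.2]
  else set0.
rewrite (_ : _ `&` _ = \bigcup_zd F zd).
  apply: countable_bigcupT_measurable; first exact: countableP.
  move=> [z d]; rewrite /F /=; case: ifPn => // _.
  rewrite -[X in measurable X]setTI.
  have := measurable_fun_ltr (mdist (pt z)) (measurable_cst (ratr d : R)).
  move=> /(_ measurableT [set true]); rewrite -[X in _ X]setTI.
  have -> : (fun x => dist x (pt z) < ratr d) @^-1` [set true] =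
    [set x | dist x (pt z) < ratr d] by [].
  by rewrite !setTI; apply.
have sym x y : dist x y = dist y x.
  by apply: eq_bigr => i _; rewrite distrC.
apply/seteqP; split => [x [_]|x [[z d] _]].
  rewrite /= in_itv /= => xr.
  (* The Lipschitz bound is used from [x] to the centre and again over the radius, hence [2 K]; the
     added 1 keeps the denominator positive when [K = 0]. *)
  pose e := (r - u x) / (2 * K + 1).
  have K1 : 0 < 2 * K + 1 by rewrite ltr_wpDl// mulr_ge0.
  have e0 : 0 < e by rewrite divr_gt0// subr_gt0.
  have ee : e / 2 < e by rewrite gtr_pMr// invf_lt1// ltr1n.
  have [d] := rat_in_itvoo ee.
  rewrite in_itv /= => /andP[ed de].
  have d0 : 0 < ratr d :> R by rewrite (lt_trans _ ed)// divr_gt0.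
  (* The [n] coordinate errors then add up to at most [n k], strictly below the radius, also for
     [n = 0]. *)
  pose k : R := ratr d / n.+1%:R.
  have k0 : 0 < k by rewrite divr_gt0// ltr0n.
  have zE i : exists z : rat, `|x ord0 i - ratr z| < k.
    have kk : x ord0 i - k < x ord0 i + k by rewrite ltrD2l gtrN.
    have [z] := rat_in_itvoo kk.
    by rewrite in_itv /= => /andP[z1 z2]; exists z; rewrite distrC ltr_distl z1.
  pose z : 'rV[rat]_n := \row_i projT1 (cid (zE i)).
  have xz : dist x (pt z) < ratr d.
    apply: (@le_lt_trans _ _ (\sum_(i < n) k)).
      apply: ler_sum => i _; rewrite !mxE; apply: ltW.
      exact: (projT2 (cid (zE i))).
    rewrite sumr_const card_ord -mulr_natr /k mulrAC ltr_pdivrMr ?ltr0n//.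
    by rewrite ltr_pM2l// ltr_nat.
  exists (z, d) => //; rewrite /F /= ifT//.
  apply: (@le_lt_trans _ _ (u x + K * ratr d + K * ratr d)).
    rewrite lerD2r; apply: le_trans (uK _ x) _; rewrite lerD2l ler_wpM2l//.
    by rewrite -/(dist _ _) sym ltW.
  rewrite -addrA -ltrBrDl.
  have -> : r - u x = e * (2 * K + 1) by rewrite /e mulfVK// gt_eqF.
  by have := ler_wpM2l K0 (ltW de); move: e0; lra.
rewrite /F /=; case: ifPn => // zr xz; split => //; rewrite /= in_itv /=.
apply: le_lt_trans zr; apply: le_trans (uK _ (pt z)) _.
by rewrite lerD2l ler_wpM2l// ltW.
Qed.

Lemma measurable_homogeneous_convex : measurable_fun [set: 'rV[R]_n] V.
Proof.
have mW : measurable_fun [set: 'rV[R]_n] W.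
  exact: measurable_lipschitz_rV W_lipschitz.
apply: (eq_measurable_fun (fun x => W x `^ beta)) => [x _|]; first exact: WK.
by apply: (measurableT_comp (measurable_powR beta)).
Qed.

End homogeneous_convex.

(** * From Lebesgue to Borel measurability *)

Section borel_approximation.
Context d (T : measurableType d) (R : realType).
Variable mu : {sigma_finite_measure set T -> \bar R}.
Let cmu := @completed_measure_extension _ T R mu.
Local Notation cT := (caratheodory_type (mu^*)%mu).

Let cmuE (A : set T) : measurable A -> cmu A = mu A.
Proof. exact: measurable_mu_extE. Qed.

Let cmeas (A : set T) : measurable A -> measurable (A : set cT).
Proof. exact: caratheodory_measurable_mu_ext. Qed.

Lemma measure_bigcup_eq0 (N : (set T)^nat) :
  (forall k, measurable (N k)) -> (forall k, mu (N k) = 0%E) ->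
  mu (\bigcup_k N k) = 0%E.
Proof.
move=> mN N0; apply/negligibleP; first exact: bigcupT_measurable.
by apply: negligible_bigcup => k; apply/negligibleP; [exact: mN|exact: N0].
Qed.

(** Measurable covers come within [1 / (k + 1)] of the outer measure, so their intersection attains
    it. *)
Lemma measurable_hull (E : set T) : exists F : set T,
  [/\ measurable F, E `<=` F & mu F = cmu E].
Proof.
have [Ey|Ey] := eqVneq (cmu E) +oo%E.
  exists setT; split => //; rewrite -cmuE//; apply/eqP; rewrite eq_le Ey leey /=.
  by rewrite -Ey; exact: le_outer_measure.
have Efin : cmu E \is a fin_num by rewrite ge0_fin_numE ?outer_measure_ge0// lt_neqAle Ey leey.
have H (k : nat) : exists F : set T, [/\ measurable F, E `<=` F &
    (mu F <= cmu E + (k.+1%:R^-1)%:E)%E].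
  have k0 : 0 < k.+1%:R^-1 :> R by rewrite invr_gt0 ltr0n.
  have [_ [A [mA EA] <-] Ak] := lb_ereal_inf_adherent k0 Efin.
  exists (\bigcup_i A i); split => //; first exact: bigcupT_measurable.
  apply: le_trans (ltW Ak).
  by apply: measure_sigma_subadditive => //; exact: bigcupT_measurable.
pose F k := projT1 (cid (H k)).
have FE k : [/\ measurable (F k), E `<=` F k &
    (mu (F k) <= cmu E + (k.+1%:R^-1)%:E)%E] by exact: (projT2 (cid (H k))).
have mF : measurable (\bigcap_k F k).
  by apply: bigcapT_measurable => k; have [] := FE k.
have EF : E `<=` \bigcap_k F k by move=> x Ex k _; have [_ sub _] := FE k; exact: sub.
exists (\bigcap_k F k); split => //.
apply/eqP; rewrite eq_le; apply/andP; split; last first.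
  by rewrite -cmuE//; exact: le_outer_measure.
apply/lee_addgt0Pr => e e0.
have [k ke] : exists k : nat, k.+1%:R^-1 < e.
  exists (Num.truncn e^-1); rewrite -[ltRHS]invrK ltf_pV2 ?posrE ?ltr0n ?invr_gt0//.
  exact: truncnS_gt.
have [mFk _ Fk] := FE k.
apply: (@le_trans _ _ (mu (F k))).
  by apply: le_measure; rewrite ?inE//; exact: bigcap_inf.
by apply: le_trans Fk _; rewrite leeD2l// lee_fin ltW.
Qed.

(** For finite measure, a hull of the set exceeds it by a null set, and a hull of that excess is the
    exceptional set. Sigma-finiteness reduces to this case piece by piece. *)
Lemma caratheodory_ae_measurable (E : set T) :
  measurable (E : set cT) -> exists B N : set T,
  [/\ measurable B, measurable N, mu N = 0%E & E `\` N = B `\` N].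
Proof.
move=> mE.
have fin_case (D : set T) : measurable (D : set cT) -> (cmu D < +oo)%E ->
    exists B N : set T,
    [/\ measurable B, measurable N, mu N = 0%E & D `\` N = B `\` N].
  move=> mD Dfin; have [F [mF DF FD]] := measurable_hull D.
  have [N [mN FDN N0]] := measurable_hull (F `\` D).
  exists F, N; split => //; last first.
    apply/seteqP; split => x [Dx Nx]; split => //; first exact: DF.
    by apply: contrapT => nDx; apply: Nx; apply: FDN.
  rewrite N0; have mFc := cmeas mF.
  have FDE : cmu F = cmu D by rewrite cmuE// FD.
  have -> : cmu (F `\` D) = (cmu F - cmu (F `&` D))%E.
    have Ffin : (cmu F < +oo)%E by rewrite FDE.
    exact: (@measureD _ _ _ cmu F D mFc mD Ffin).
  rewrite setIidr// FDE subee// ge0_fin_numE//; exact: outer_measure_ge0.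
have /sigma_finiteP[S [TS _ Sfin]] := sigma_finiteT mu.
have H (k : nat) : exists BN : set T * set T, [/\ measurable BN.1, measurable BN.2,
    mu BN.2 = 0%E & (E `&` S k) `\` BN.2 = BN.1 `\` BN.2].
  have [mS Sk] := Sfin k.
  have [||B [N BN]] := fin_case (E `&` S k).
  - by apply: measurableI => //; exact: cmeas.
  - apply: (@le_lt_trans _ _ (mu (S k))); last exact: Sk.
    rewrite -(cmuE mS); apply: le_outer_measure.
    exact: subIsetr.
  - by exists (B, N).
pose BN k := projT1 (cid (H k)).
have BNE k : [/\ measurable (BN k).1, measurable (BN k).2,
    mu (BN k).2 = 0%E & (E `&` S k) `\` (BN k).2 = (BN k).1 `\` (BN k).2].
  exact: (projT2 (cid (H k))).
exists (\bigcup_k ((BN k).1 `\` (BN k).2)), (\bigcup_k (BN k).2); split.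
- by apply: bigcupT_measurable => k; have [mB mN _ _] := BNE k; exact: measurableD.
- by apply: bigcupT_measurable => k; have [] := BNE k.
- by apply: measure_bigcup_eq0 => k; have [] := BNE k.
- apply/seteqP; split => x [].
  + move=> Ex Nx; split => //.
    have [k _ Skx] : (\bigcup_k S k) x by rewrite -TS.
    exists k => //; have [_ _ _ <-] := BNE k; split => //.
    by move=> Nkx; apply: Nx; exists k.
  + move=> [k _]; have [_ _ _ <-] := BNE k; move=> [[Ex _] _] Nx.
    by split.
Qed.

(* Enlarging [N] is allowed so that several functions can share a null set. *)
Lemma caratheodory_ae_measurable_fun (f : cT -> R) :
  measurable_fun [set: cT] f -> exists N : set T,
  [/\ measurable N, mu N = 0%E & forall M : set T, measurable M -> N `<=` M ->
    measurable_fun (~` M) (f : T -> R)].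
Proof.
move=> mf.
have H (r : rat) : exists BN : set T * set T, [/\ measurable BN.1, measurable BN.2,
    mu BN.2 = 0%E & [set x | ratr r < f x] `\` BN.2 = BN.1 `\` BN.2].
  have [|B [N BN]] := @caratheodory_ae_measurable [set x | ratr r < f x].
    have := measurable_fun_ltr (measurable_cst (ratr r : R)) mf.
    by move=> /(_ measurableT [set true] Logic.I); rewrite setTI.
  by exists (B, N).
pose BN r := projT1 (cid (H r)).
have BNE r : [/\ measurable (BN r).1, measurable (BN r).2,
    mu (BN r).2 = 0%E & [set x | ratr r < f x] `\` (BN r).2 = (BN r).1 `\` (BN r).2].
  exact: (projT2 (cid (H r))).
(* An enumeration of the rationals, so that countably many levels share one null set; the default 0
   only repeats a level. *)
pose q (k : nat) : rat := odflt 0 (unpickle k).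
exists (\bigcup_k (BN (q k)).2).
have mN : measurable (\bigcup_k (BN (q k)).2).
  by apply: bigcupT_measurable => k; have [] := BNE (q k).
split => //.
  by apply: measure_bigcup_eq0 => k; have [] := BNE (q k).
move=> M mM NM mMc.
apply: (measurability _ (RGenOInfty.measurableE R)) => // _ [_ [a ->] <-].
rewrite (_ : _ `&` _ = \bigcup_(r : rat)
   (if a <= ratr r then (BN r).1 `\` M else set0)).
  apply: bigcupT_measurable_rat => r; case: ifPn => // _.
  by apply: measurableD => //; have [] := BNE r.
have key r x : ~ M x -> (BN r).1 x <-> ratr r < f x.
  move=> Mx; have nN : ~ (BN r).2 x.
    move=> Nx; apply: Mx; apply: NM; exists (pickle r) => //=.
    by rewrite /q pickleK.
  have [_ _ _ /seteqP[h1 h2]] := BNE r; split => [Bx|rx].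
    by have [] := h2 x (conj Bx nN).
  by have [] := h1 x (conj rx nN).
apply/seteqP; split => x.
  move=> [Mx]; rewrite /= in_itv /= andbT => ax.
  have [r] := rat_in_itvoo ax; rewrite in_itv /= => /andP[ar rx].
  exists r => //; rewrite ltW//; split => //; exact/key.
move=> [r _]; case: ifPn => // ar [Bx Mx]; split => //.
by rewrite /= in_itv /= andbT; apply: (le_lt_trans ar); exact/(key r x Mx).
Qed.

End borel_approximation.

(** * Gibbs measures *)

Section integral_density.
Import HBNNSimple.
Local Open Scope ereal_scope.
Context d (T : measurableType d) (R : realType).
Variables (mu nu : {measure set T -> \bar R}) (e : T -> R).
Hypotheses (me : measurable_fun setT e) (e0 : forall x, (0 <= e x)%R).
Hypothesis nuE : forall A, measurable A -> nu A = \int[mu]_(x in A) (e x)%:E.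

(** On indicators this is [nuE]; linearity extends it to simple functions, and monotone convergence
    to all nonnegative measurable [f]. *)
Lemma integral_density (f : T -> \bar R) :
  measurable_fun setT f -> (forall x, 0 <= f x) ->
  \int[nu]_x f x = \int[mu]_x (f x * (e x)%:E).
Proof.
move=> mf f0; pose h := nnsfun_approx measurableT mf.
have mee : measurable_fun setT (EFin \o e) by exact/measurable_EFinP.
have fE x : f x = lim ((EFin \o h k) x @[k --> \oo]).
  by apply/esym/cvg_lim => //; exact: cvg_nnsfun_approx.
have -> : \int[nu]_x f x = lim (\int[nu]_x (EFin \o h k) x @[k --> \oo]).
  under eq_integral => x _ do rewrite fE.
  apply: monotone_convergence => //.
  - by move=> k; exact/measurable_EFinP.
  - by move=> k x _ /=; rewrite lee_fin.
  - by move=> x _ i j ij; rewrite lee_fin; exact/lefP/nd_nnsfun_approx.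
have -> : \int[mu]_x (f x * (e x)%:E) =
    lim (\int[mu]_x ((EFin \o h k) x * (e x)%:E) @[k --> \oo]).
  have feE x : f x * (e x)%:E = lim ((EFin \o h k) x * (e x)%:E @[k --> \oo]).
    apply/esym/cvg_lim => //.
    apply: (@cvgeZr _ _ _ (fun k => (EFin \o h k) x) _ (e x)%:E) => //.
    exact: cvg_nnsfun_approx.
  under eq_integral => x _ do rewrite feE.
  apply: monotone_convergence => //.
  - move=> k; have mh : measurable_fun setT (EFin \o h k) by exact/measurable_EFinP.
    exact: (emeasurable_funM mh mee).
  - by move=> k x _ /=; rewrite mule_ge0 ?lee_fin.
  - move=> x _ i j ij; rewrite lee_wpmul2r ?lee_fin//.
    exact/lefP/nd_nnsfun_approx.
suff -> : (fun k => \int[nu]_x (EFin \o h k) x) =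
    (fun k => \int[mu]_x ((EFin \o h k) x * (e x)%:E)) by [].
apply/funext => k.
transitivity (\int[nu]_x
   (\sum_(y \in range (h k)) (y * \1_(h k @^-1` [set y]) x)%:E)).
  by apply: eq_integral => t _; rewrite /= fimfunE -fsumEFin.
have indich (r : R) : measurable_fun setT (fun x => (r * \1_(h k @^-1` [set r]) x)%:E).
  by apply/measurable_EFinP; exact: measurable_funM.
rewrite ge0_integral_fsum//; last by move=> m y _; exact: nnfun_muleindic_ge0.
transitivity (\int[mu]_x (\sum_(y \in range (h k))
    (y * \1_(h k @^-1` [set y]) x)%:E * (e x)%:E)); last first.
  apply: eq_integral => x _.
  rewrite -ge0_mule_fsuml => [|y]; last exact: nnfun_muleindic_ge0.
  by rewrite fsumEFin// -(fimfunE _ x).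
rewrite ge0_integral_fsum//; last 2 first.
  - by move=> y; exact: (emeasurable_funM (indich y) mee).
  - by move=> m y _; rewrite mule_ge0 ?lee_fin ?e0// -lee_fin nnfun_muleindic_ge0.
apply: eq_fsbigr => r rhn.
under eq_integral do rewrite EFinM.
rewrite integralZl_indic_nnsfun => //.
under [RHS]eq_integral do rewrite EFinM -muleA.
rewrite ge0_integralZl//.
- under [in RHS]eq_integral do rewrite muleC.
  rewrite [in RHS](eq_integral ((EFin \o e) \_ (h k @^-1` [set r]))); last first.
    by move=> x xE; rewrite epatch_indic.
  by rewrite -integral_mkcond integral_indic// setIT nuE.
- by apply: emeasurable_funM => //; exact/measurable_EFinP.
- by move=> t _; rewrite mule_ge0 ?lee_fin.
- by move: rhn; rewrite inE => -[t _ <-]; rewrite lee_fin.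
Qed.

End integral_density.

Lemma measurable_fun_lebesgue_space d (T : measurableType d) (R : realType)
    (n : nat) (f : 'rV[R]_n -> T) :
  measurable_fun setT f -> measurable_fun [set: lebesgue_space R n] f.
Proof.
move=> mf _ B mB; have := mf measurableT B mB.
by rewrite !setTI; exact: measurable_lebesgue_space.
Qed.

(** The identity map pushes the completed measure forward to the Borel one. *)
Lemma integral_completed_lebesgue_rV (R : realType) (n : nat)
    (f : 'rV[R]_n -> \bar R) :
  measurable_fun setT f -> (forall x, 0 <= f x)%E ->
  (\int[completed_lebesgue_rV R n]_x f x = \int[lebesgue_rV R n]_x f x)%E.
Proof.
move=> mf f0.
have mid : measurable_fun [set: lebesgue_space R n] (id : lebesgue_space R n -> 'rV[R]_n).
  by apply: measurable_fun_lebesgue_space; exact: measurable_id.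
have := @ge0_integral_pushforward _ _ _ _ R _ mid
  (completed_lebesgue_rV R n) setT f measurableT mf.
rewrite preimage_setT => H; rewrite -[LHS]H; last by move=> x _; exact: f0.
by apply: eq_measure_integral => A mA _; exact: completed_lebesgue_rVE.
Qed.

Section gibbs_prekopa_leindler.
Context {R : realType} {n : nat}.
Variables (beta : R) (V : 'rV[R]_n -> R).
Hypotheses (beta1 : 1 < beta) (Vconv : convex_function [set: 'rV[R]_n] V)
  (Vhom : homogeneous_fun beta V).
Local Notation q := (beta / (beta - 1)).

(** The powers [a^n] and [b^n] are the Jacobians of the dilations by [a] and [b]. The normalisation
    [Z] passes through because the weights [m] and [l] add up to 1. *)
Lemma gibbs_prekopa_leindler (Z m l a b : R) (F G : 'rV[R]_n -> R)
    (H : 'rV[R]_n -> \bar R) :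
  let e x := expR (- V x) / Z in
  0 < Z -> 0 < m -> 0 < l -> m + l = 1 -> 0 < a -> 0 < b ->
  m * a `^ q + l * b `^ q = 1 ->
  measurable_fun setT F -> measurable_fun setT G -> measurable_fun setT H ->
  (forall x, 0 <= F x) -> (forall x, 0 <= G x) -> (forall x, 0 <= H x)%E ->
  (forall x y, ((F x `^ m * G y `^ l)%:E <= H ((m * a) *: x + (l * b) *: y)%R)%E) ->
  (((a ^+ n)%:E * \int[lebesgue_rV R n]_x ((F x)%:E * (e x)%:E)) `^ m *
   ((b ^+ n)%:E * \int[lebesgue_rV R n]_x ((G x)%:E * (e x)%:E)) `^ l <=
   \int[lebesgue_rV R n]_x (H x * (e x)%:E))%E.
Proof.
move=> e Z0 m0 l0 ml a0 b0 mab mF mG mH F0 G0 H0 FGH.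
have e0 x : 0 < e x by rewrite divr_gt0// expR_gt0.
have mV := measurable_homogeneous_convex beta1 Vconv Vhom.
have me : measurable_fun setT e.
  apply: measurable_funM; last exact: measurable_cst.
  apply: (measurableT_comp (@measurable_expR R)).
  exact: measurable_realfun.measurable_funN.
have mee : measurable_fun setT (EFin \o e) by exact/measurable_EFinP.
have mprod (K : 'rV[R]_n -> R) : measurable_fun setT K ->
    measurable_fun setT (fun x => (K x)%:E * (e x)%:E)%E.
  by move=> mK; apply: emeasurable_funM => //; exact/measurable_EFinP.
have scale (K : 'rV[R]_n -> R) (c : R) : 0 < c -> measurable_fun setT K ->
    (forall x, 0 <= K x) ->
    ((c ^+ n)%:E * \int[lebesgue_rV R n]_x ((K x)%:E * (e x)%:E) =
     \int[lebesgue_rV R n]_x ((K (c^-1 *: x))%:E * (e (c^-1 *: x))%:E))%E.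
  move=> c0 mK K0.
  rewrite (@integral_scale_rV _ _ c^-1 (fun x => (K x)%:E * (e x)%:E)%E) ?invr_gt0//.
  - by rewrite exprVn invrK.
  - exact: mprod.
  - by move=> x; rewrite mule_ge0 ?lee_fin// ltW.
rewrite !scale//.
have mE : m = 1 - l by rewrite -ml addrK.
have l01 : 0 < l < 1 by rewrite l0 /= -ml ltrDr.
have mscale (K : 'rV[R]_n -> R) (c : R) : measurable_fun setT K ->
    measurable_fun setT (fun x : 'rV[R]_n => (K (c^-1 *: x)%R)%:E * (e (c^-1 *: x)%R)%:E)%E.
  move=> mK; exact: (measurableT_comp (mprod K mK) (@measurable_scale_rV R n c^-1)).
rewrite mE; apply: prekopa_leindler => //.
- exact: mscale.
- exact: mscale.
- exact: emeasurable_funM.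
- by move=> x; rewrite mule_ge0 ?lee_fin// ltW.
- by move=> x; rewrite mule_ge0 ?lee_fin// ltW.
- by move=> x; rewrite mule_ge0 ?lee_fin// ltW.
rewrite -mE => x y.
set u := a^-1 *: x; set v := b^-1 *: y.
change (((F u * e u) `^ m * (G v * e v) `^ l)%:E <=
  H ((m *: x + l *: y)%R) * (e (m *: x + l *: y)%R)%:E)%E.
have xu : m *: x = (m * a) *: u by rewrite scalerA mulfK// gt_eqF.
have yv : l *: y = (l * b) *: v by rewrite scalerA mulfK// gt_eqF.
have step : e u `^ m * e v `^ l <= e (m *: x + l *: y).
  have -> : e u `^ m * e v `^ l = expR (- (m * V u + l * V v)) / Z.
    have pw r w : 0 < r -> e w `^ r = expR (- (r * V w)) * Z^-1 `^ r.
      move=> r0; rewrite /e powRM ?expR_ge0 ?invr_ge0 ?(ltW Z0)//.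
      by rewrite -expRM mulNr (mulrC r).
    rewrite !pw// mulrACA -expRD -powRD; last by rewrite ml oner_eq0.
    by rewrite ml powRr1 ?invr_ge0 ?(ltW Z0)// opprD.
  rewrite ler_pM2r ?invr_gt0// ler_expR lerN2.
  exact: (homogeneous_convex_comb beta1 Vconv Vhom).
rewrite (powRM m (F0 u) (ltW (e0 u))) (powRM l (G0 v) (ltW (e0 v))) mulrACA.
have := FGH u v; rewrite -xu -yv => {}FGH.
rewrite EFinM; apply: lee_pmul => //; rewrite lee_fin.
  by rewrite mulr_ge0 ?powR_ge0.
by rewrite mulr_ge0 ?powR_ge0.
Qed.

End gibbs_prekopa_leindler.

Section gibbs_brunn_minkowski.
Context {R : realType} {n : nat}.
Variables (beta t : R) (V : 'rV[R]_n -> R) (nu : probability (lebesgue_space R n) R).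
Variables (f g h : 'rV[R]_n -> R).
Hypotheses (beta_gt1 : 1 < beta) (t01 : 0 < t < 1)
  (V_convex : convex_function [set: 'rV[R]_n] V)
  (V_homog : homogeneous_fun beta V)
  (nu_gibbs : gibbs_measure V nu)
  (f_ge0 : forall x, 0 <= f x)
  (g_ge0 : forall x, 0 <= g x)
  (h_ge0 : forall x, 0 <= h x)
  (f_meas : measurable_fun [set: lebesgue_space R n] f)
  (g_meas : measurable_fun [set: lebesgue_space R n] g)
  (h_meas : measurable_fun [set: lebesgue_space R n] h)
  (f_decr : radially_decreasing f) (g_decr : radially_decreasing g)
  (f_int : nu.-integrable [set: lebesgue_space R n] (EFin \o f))
  (g_int : nu.-integrable [set: lebesgue_space R n] (EFin \o g)).
Local Notation q := (beta / (beta - 1)).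

Let Z : R := fine (\int[completed_lebesgue_rV R n]_x (expR (- V x))%:E)%E.
Let e (x : 'rV[R]_n) := expR (- V x) / Z.

Let me : measurable_fun setT e.
Proof.
apply: measurable_funM; last exact: measurable_cst.
apply: (measurableT_comp (@measurable_expR R)).
apply: measurable_realfun.measurable_funN.
exact: (measurable_homogeneous_convex beta_gt1 V_convex V_homog).
Qed.

Let nuE (A : set (lebesgue_space R n)) : measurable A ->
  nu A = (\int[completed_lebesgue_rV R n]_(x in A) (e x)%:E)%E.
Proof. by have [_] := nu_gibbs; apply. Qed.

(** As the inverse of 0 is 0, [Z = 0] would make the density vanish, against total mass 1. *)
Let Z_gt0 : 0 < Z.
Proof.
have Z0 : 0 <= Z by apply: fine_ge0; apply: integral_ge0 => x _; rewrite lee_fin expR_ge0.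
rewrite lt_neqAle Z0 andbT eq_sym; apply/eqP => Z00.
have := probability_setT nu; rewrite nuE//.
under eq_integral do rewrite /e Z00 invr0 mulr0.
by rewrite integral0 => /eqP; rewrite eq_sym onee_eq0.
Qed.

Let e_ge0 x : 0 <= e x. Proof. by rewrite divr_ge0 ?expR_ge0 ?ltW. Qed.

Let integral_nu (F : 'rV[R]_n -> \bar R) :
  measurable_fun setT F -> (forall x, 0 <= F x)%E ->
  (\int[nu]_x F x = \int[lebesgue_rV R n]_x (F x * (e x)%:E))%E.
Proof.
move=> mF F0.
rewrite (integral_density (measurable_fun_lebesgue_space me) e_ge0 nuE)//; last first.
  exact: measurable_fun_lebesgue_space.
rewrite (@integral_completed_lebesgue_rV _ _ (fun x => F x * (e x)%:E)%E)//.
- by apply: emeasurable_funM => //; exact/measurable_EFinP.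
- by move=> x; rewrite mule_ge0 ?lee_fin.
Qed.

Let nu_null (N : set 'rV[R]_n) : measurable N -> lebesgue_rV R n N = 0%E -> nu N = 0%E.
Proof.
move=> mN N0; have mNl := measurable_lebesgue_space mN.
have mel : measurable_fun [set: lebesgue_space R n] (EFin \o e).
  by apply/measurable_EFinP; exact: measurable_fun_lebesgue_space.
rewrite nuE//.
have H := @ge0_negligible_integral _ _ _ (completed_lebesgue_rV R n) N N (EFin \o e)
  mNl mNl (measurable_funTS mel).
rewrite H ?setDv ?integral_set0//; first by move=> x _; rewrite lee_fin.
by rewrite -N0; exact: completed_lebesgue_rVE.
Qed.

(** [A] and [B] stand for [c^{1/p}] and [d^{1/p}]. They are left abstract so that the cases [p = 0],
    [p] finite and [p] infinite share one proof. *)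
Lemma gibbs_geometric_mean (m l a b c d A B : R) :
  0 < m -> 0 < l -> m + l = 1 -> m * c = 1 - t -> l * d = t ->
  0 < a <= c -> 0 < b <= d -> m * a `^ q + l * b `^ q = 1 -> 0 <= A -> 0 <= B ->
  (forall x0 x1, (A * f x0) `^ m * (B * g x1) `^ l <=
    h ((1 - t) *: x0 + t *: x1)) ->
  (((a ^+ n * (A * \int[nu]_x f x)) `^ m *
    (b ^+ n * (B * \int[nu]_x g x)) `^ l)%:E <= \int[nu]_x (h x)%:E)%E.
Proof.
move=> m0 l0 ml mc ld /andP[a0 ac] /andP[b0 bd] mab A0 B0 fgh.
have c0 := lt_le_trans a0 ac; have d0 := lt_le_trans b0 bd.
have [Nf [mNf Nf0 mf]] := @caratheodory_ae_measurable_fun _ _ R (lebesgue_rV R n) f f_meas.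
have [Ng [mNg Ng0 mg]] := @caratheodory_ae_measurable_fun _ _ R (lebesgue_rV R n) g g_meas.
have [Nh [mNh Nh0 mh]] := @caratheodory_ae_measurable_fun _ _ R (lebesgue_rV R n) h h_meas.
pose N := Nf `|` Ng `|` Nh.
have mN : measurable N by do 2 apply: measurableU => //.
have N0 : lebesgue_rV R n N = 0%E.
  apply/negligibleP => //.
  by do 2 ?apply: negligibleU; apply/negligibleP.
have {}mf : measurable_fun (~` N) f by apply: mf => // x Nx; left; left.
have {}mg : measurable_fun (~` N) g by apply: mg => // x Nx; left; right.
have {}mh : measurable_fun (~` N) h by apply: mh => // x Nx; right.
have nuN : nu N = 0%E by exact: nu_null.
have mNC : measurable (~` N) by exact: measurableC.
have mpatch (u : 'rV[R]_n -> R) : measurable_fun (~` N) u ->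
    measurable_fun setT (u \_ (~` N)).
  by move=> mu; apply/measurable_restrict => //; rewrite setTI.
have patchR (u : 'rV[R]_n -> R) x : (u \_ (~` N)) x = if x \in ~` N then u x else 0.
  by rewrite patchE.
(* On the null set [N] the left-hand functions drop to 0 and the right-hand one rises to [+oo], so
   the inequality survives wherever the three points fall. *)
pose F x := A * (f \_ (~` N)) x; pose G x := B * (g \_ (~` N)) x.
pose H x : \bar R := if x \in N then +oo%E else (h x)%:E.
have aeN (u v : lebesgue_space R n -> \bar R) : (forall x, x \notin N -> u x = v x) ->
    ae_eq nu setT u v.
  move=> uv; exists N; split => //; first exact: measurable_lebesgue_space.
  move=> x /= uvx; apply: contrapT => Nx; apply: uvx => _; apply: uv.
  by rewrite notin_setE.
have mF : measurable_fun setT F by apply: measurable_funM => //; exact: mpatch.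
have mG : measurable_fun setT G by apply: measurable_funM => //; exact: mpatch.
have mH : measurable_fun setT H.
  have -> : H = (((EFin \o h) \_ (~` N)) \+ ((cst +oo%E) \_ N))%E.
    apply/funext => x; rewrite /H /= !patchE in_setC; case: ifPn => /= xN.
      by rewrite add0e.
    by rewrite adde0.
  apply: emeasurable_funD; apply/measurable_restrict; rewrite ?setTI//.
  exact/measurable_EFinP.
have F0 x : 0 <= F x by rewrite /F patchR; case: ifP; rewrite ?mulr0 ?mulr_ge0.
have G0 x : 0 <= G x by rewrite /G patchR; case: ifP; rewrite ?mulr0 ?mulr_ge0.
have H0 x : (0 <= H x)%E by rewrite /H; case: ifP; rewrite ?lee_fin ?leey.
have intE (u : 'rV[R]_n -> R) (K : R) : 0 <= K -> (forall x, 0 <= u x) ->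
    measurable_fun [set: lebesgue_space R n] u -> measurable_fun (~` N) u ->
    nu.-integrable [set: lebesgue_space R n] (EFin \o u) ->
    ((K * \int[nu]_x u x)%:E =
     \int[lebesgue_rV R n]_x ((K * (u \_ (~` N)) x)%:E * (e x)%:E))%E.
  move=> K0 u0 mul mu iu.
  rewrite -(@integral_nu (fun x => (K * (u \_ (~` N)) x)%:E)); last 2 first.
  - by apply/measurable_EFinP; apply: measurable_funM => //; exact: mpatch.
  - by move=> x; rewrite lee_fin patchR; case: ifP; rewrite ?mulr0 ?mulr_ge0.
  have mue : measurable_fun [set: lebesgue_space R n] (EFin \o u) by exact/measurable_EFinP.
  have ue0 (x : lebesgue_space R n) : setT x -> (0 <= (EFin \o u) x)%E.
    by move=> _; rewrite /= lee_fin.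
  have mv : measurable_fun [set: lebesgue_space R n]
      (fun x : 'rV[R]_n => (K * (u \_ (~` N)) x)%:E).
    apply: measurable_fun_lebesgue_space; apply/measurable_EFinP.
    by apply: measurable_funM => //; exact: mpatch.
  have K0e : (0 <= K%:E)%E by rewrite lee_fin.
  rewrite EFinM /Rintegral fineK; last exact: integrable_fin_num.
  transitivity (\int[nu]_x (K%:E * (EFin \o u) x))%E.
    exact: (esym (@ge0_integralZl _ _ _ nu _ measurableT _ mue K%:E ue0 K0e)).
  have mKu := measurable_funeM K%:E mue.
  apply: (@ge0_ae_eq_integral _ _ _ nu setT _ _ measurableT mKu mv).
  - by move=> x _; rewrite mule_ge0 ?lee_fin.
  - by move=> x _; rewrite lee_fin patchR; case: ifP; rewrite ?mulr0 ?mulr_ge0.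
  - by apply: aeN => x xN; rewrite patchR in_setC xN.
have intH : (\int[nu]_x (h x)%:E = \int[lebesgue_rV R n]_x (H x * (e x)%:E))%E.
  have mhe : measurable_fun [set: lebesgue_space R n] (fun x : 'rV[R]_n => (h x)%:E).
    exact/measurable_EFinP.
  have mHl := measurable_fun_lebesgue_space mH.
  rewrite -(integral_nu mH H0).
  apply: (@ge0_ae_eq_integral _ _ _ nu setT _ _ measurableT mhe mHl).
  - by move=> x _; rewrite lee_fin.
  - by move=> x _; exact: H0.
  - by apply: aeN => x xN; rewrite /H (negbTE xN).
have FGH x y : ((F x `^ m * G y `^ l)%:E <= H ((m * a) *: x + (l * b) *: y)%R)%E.
  rewrite /H; case: ifPn => zN; first by rewrite leey.
  rewrite lee_fin.
  pose x0 := (a / c) *: x; pose x1 := (b / d) *: y.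
  have -> : (m * a) *: x + (l * b) *: y = (1 - t) *: x0 + t *: x1.
    have e1 : (1 - t) * (a / c) = m * a by rewrite -mc; field; rewrite gt_eqF.
    have e2 : t * (b / d) = l * b by rewrite -ld; field; rewrite gt_eqF.
    by rewrite /x0 /x1 !scalerA e1 e2.
  apply: le_trans (fgh x0 x1).
  have Ff : F x <= A * f x0.
    rewrite /F patchR; case: ifP => _; last by rewrite mulr0 mulr_ge0.
    rewrite ler_wpM2l//; apply: f_decr.
    by rewrite divr_ge0 ?(ltW a0) ?(ltW c0)//= ler_pdivrMr// mul1r.
  have Gg : G y <= B * g x1.
    rewrite /G patchR; case: ifP => _; last by rewrite mulr0 mulr_ge0.
    rewrite ler_wpM2l//; apply: g_decr.
    by rewrite divr_ge0 ?(ltW b0) ?(ltW d0)//= ler_pdivrMr// mul1r.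
  apply: ler_pM; rewrite ?powR_ge0//.
    by apply: ge0_ler_powR => //; rewrite ?nnegrE ?(ltW m0) ?(le_trans (F0 x)).
  by apply: ge0_ler_powR => //; rewrite ?nnegrE ?(ltW l0) ?(le_trans (G0 y)).
have := gibbs_prekopa_leindler beta_gt1 V_convex V_homog Z_gt0 m0 l0 ml a0 b0 mab
  mF mG mH F0 G0 H0 FGH.
by rewrite -/e -intH /F /G -!intE.
Qed.

(** [k] is [1/p], and 0 for infinite [p]. The pointwise bound is required for all splittings because
    the weights are chosen only here, from the two integrals. *)
Lemma gibbs_power_mean (k r : R) :
  let I := \int[nu]_x f x in let J := \int[nu]_x g x in
  0 < r -> r^-1 = k + q * n%:R -> 0 < I -> 0 < J ->
  (forall m l c d x0 x1, 0 < m -> 0 < l -> m + l = 1 -> m * c = 1 - t ->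
    l * d = t -> (c `^ k * f x0) `^ m * (d `^ k * g x1) `^ l <=
    h ((1 - t) *: x0 + t *: x1)) ->
  ((((1 - t) * I `^ r + t * J `^ r) `^ r^-1)%:E <= \int[nu]_x (h x)%:E)%E.
Proof.
move=> I J r0 rE I0 J0 fgh.
have [m [l [c [d [[m0 l0 c0 d0] [ml mc ld] cI dJ]]]]] :=
  power_mean_weights t01 r0 I0 J0.
have cd1 : m * c + l * d = 1 by rewrite mc ld subrK.
have q1 : 1 < q by rewrite ltr_pdivlMr ?subr_gt0// mul1r ltrBlDr ltrDl.
have [a [b [ac bd ab1 abcd]]] := scaling_pair_exists m0 l0 ml q1 c0 d0 cd1.
have := gibbs_geometric_mean m0 l0 ml mc ld ac bd ab1 (powR_ge0 c k) (powR_ge0 d k)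
  (fun x0 x1 => fgh m l c d x0 x1 m0 l0 ml mc ld).
apply: le_trans; rewrite lee_fin.
have /andP[a0 _] := ac; have /andP[b0 _] := bd.
by apply: (weighted_mean_le a0 b0 c0 d0 I0 J0 ml abcd); rewrite -rE.
Qed.

End gibbs_brunn_minkowski.

(** * Endpoint weights and the case analysis on the index *)

Lemma power_mean_t0 (R : realType) (r x y : R) :
  0 < x -> 0 < y -> power_mean r%:E 0 x y = x.
Proof.
move=> x0 y0; rewrite /power_mean mulr_gt0// subr0 !mul1r mul0r addr0.
case: eqP => [_|/eqP r0]; first by rewrite powRr1 ?powRr0 ?mulr1// ltW.
by rewrite -powRrM mulfV// powRr1// ltW.
Qed.

Lemma power_mean_t1 (R : realType) (r x y : R) :
  0 < x -> 0 < y -> power_mean r%:E 1 x y = y.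
Proof.
move=> x0 y0; rewrite /power_mean mulr_gt0// subrr !mul1r mul0r add0r.
case: eqP => [_|/eqP r0]; first by rewrite powRr1 ?powRr0 ?mul1r// ltW.
by rewrite -powRrM mulfV// powRr1// ltW.
Qed.

Lemma Rintegral_gt0_ex d (T : measurableType d) (R : realType)
    (mu : {measure set T -> \bar R}) (u : T -> R) :
  (forall x, 0 <= u x) -> 0 < \int[mu]_x u x -> exists x, 0 < u x.
Proof.
move=> u0 iu; apply: contrapT => nu.
have u00 x : u x = 0.
  apply/eqP; rewrite eq_le u0 andbT leNgt; apply/negP => ux.
  by apply: nu; exists x.
move: iu; rewrite /Rintegral; under eq_integral do rewrite u00.
by rewrite integral0 ltxx.
Qed.

Lemma Rintegral_le_integral d (T : measurableType d) (R : realType)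
    (mu : {measure set T -> \bar R}) (u h : T -> R) :
  measurable_fun setT h -> (forall x, 0 <= u x) ->
  mu.-integrable setT (EFin \o u) -> (forall x, u x <= h x) ->
  ((\int[mu]_x u x)%:E <= \int[mu]_x (h x)%:E)%E.
Proof.
move=> mh u0 iu uh; rewrite /Rintegral fineK; last exact: integrable_fin_num.
apply: ge0_le_integral => //.
- by move=> x _; rewrite lee_fin.
- exact: (measurable_int mu iu).
- exact/measurable_EFinP.
- by move=> x _; rewrite lee_fin.
Qed.

Theorem theorem1p8 (R : realType) (n : nat) (beta t : R) (p : \bar R)
    (V : 'rV[R]_n -> R) (nu : probability (lebesgue_space R n) R)
    (f g h : 'rV[R]_n -> R)
    (n_ge1 : (1 <= n)%N) (beta_gt1 : 1 < beta)
    (V_convex : convex_function [set: 'rV[R]_n] V)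
    (V_homog : homogeneous_fun beta V)
    (nu_gibbs : gibbs_measure V nu)
    (t01 : 0 <= t <= 1) (p_ge0 : (0 <= p)%E)
    (f_ge0 : forall x, 0 <= f x)
    (g_ge0 : forall x, 0 <= g x)
    (h_ge0 : forall x, 0 <= h x)
    (f_meas : measurable_fun [set: lebesgue_space R n] f)
    (g_meas : measurable_fun [set: lebesgue_space R n] g)
    (h_meas : measurable_fun [set: lebesgue_space R n] h)
    (f_decr : radially_decreasing f) (g_decr : radially_decreasing g)
    (f_int : nu.-integrable [set: lebesgue_space R n] (EFin \o f))
    (g_int : nu.-integrable [set: lebesgue_space R n] (EFin \o g))
    (fgh : forall x0 x1 : 'rV[R]_n,
      power_mean p t (f x0) (g x1) <= h ((1 - t) *: x0 + t *: x1)) :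
  ((power_mean (mean_index n beta p) t
      (\int[nu]_x f x)%R (\int[nu]_x g x)%R)%:E
     <= \int[nu]_x (h x)%:E)%E.
Proof.
have int_h_ge0 : (0 <= \int[nu]_x (h x)%:E)%E.
  by apply: integral_ge0 => x _; rewrite lee_fin.
have I_ge0 : 0 <= \int[nu]_x f x by exact: Rintegral_ge0.
have J_ge0 : 0 <= \int[nu]_x g x by exact: Rintegral_ge0.
(* If one of the integrals is 0, so is their mean. *)
have [IJ|nIJ] := boolP (0 < (\int[nu]_x f x) * (\int[nu]_x g x)); last first.
  by rewrite /power_mean (negbTE nIJ).
have I0 : 0 < \int[nu]_x f x.
  by rewrite lt_neqAle eq_sym I_ge0 andbT; apply: contraTneq IJ => ->; rewrite mul0r ltxx.
have J0 : 0 < \int[nu]_x g x.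
  by rewrite lt_neqAle eq_sym J_ge0 andbT; apply: contraTneq IJ => ->; rewrite mulr0 ltxx.
have [r rE] : exists r, mean_index n beta p = r%:E.
  by case: p {fgh p_ge0} => [s| |]; eexists.
have [t0|t_neq0] := eqVneq t 0.
  rewrite rE t0 power_mean_t0//; apply: Rintegral_le_integral => // x.
  (* [power_mean] is 0 as soon as one argument is, so deducing [f x <= h x] takes a point where [g]
     is positive. *)
  have [y gy] := @Rintegral_gt0_ex _ (lebesgue_space R n) R nu g g_ge0 J0.
  have := fgh x y; rewrite t0 subr0 scale1r scale0r addr0; apply: le_trans.
  have := f_ge0 x; rewrite le_eqVlt => /orP[/eqP <-|fx].
    by rewrite /power_mean mul0r ltxx.
  case: p p_ge0 {fgh rE} => [s| |]// _; first by rewrite power_mean_t0.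
  by rewrite /power_mean mulr_gt0// le_max lexx.
have [t1|t_neq1] := eqVneq t 1.
  rewrite rE t1 power_mean_t1//; apply: Rintegral_le_integral => // y.
  have [x fx] := @Rintegral_gt0_ex _ (lebesgue_space R n) R nu f f_ge0 I0.
  have := fgh x y; rewrite t1 subrr scale1r scale0r add0r; apply: le_trans.
  have := g_ge0 y; rewrite le_eqVlt => /orP[/eqP <-|gy].
    by rewrite /power_mean mulr0 ltxx.
  case: p p_ge0 {fgh rE} => [s| |]// _; first by rewrite power_mean_t1.
  by rewrite /power_mean mulr_gt0// le_max lexx orbT.
have /andP[t_ge0 t_le1] := t01.
have t_gt0 : 0 < t by rewrite lt_neqAle eq_sym t_neq0.
have t_lt1 : t < 1 by rewrite lt_neqAle t_neq1.
have {t01 t_neq0 t_neq1 t_ge0 t_le1} t01 : 0 < t < 1 by rewrite t_gt0.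
have n0 : 0 < n%:R :> R by rewrite ltr0n.
have b1 : 0 < beta - 1 by rewrite subr_gt0.
have b0 : 0 < beta by rewrite (lt_trans ltr01).
have power_meanE s : 0 < s -> power_mean s%:E t (\int[nu]_x f x) (\int[nu]_x g x) =
    ((1 - t) * (\int[nu]_x f x) `^ s + t * (\int[nu]_x g x) `^ s) `^ s^-1.
  by move=> s0; rewrite /power_mean IJ gt_eqF.
case: p p_ge0 fgh {r rE} => [s| |]//.
- rewrite lee_fin le_eqVlt => /orP[/eqP <-|s0] fgh.
    (* For [p = 0] the index is 0 as well and the hypothesis is already a geometric mean:
       [m = 1 - t], [l = t] and [a = b = c = d = 1]. *)
    rewrite /= !(mulr0, mul0r).
    have mc : (1 - t) * 1 = 1 - t by rewrite mulr1.
    have ld : t * 1 = t by rewrite mulr1.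
    have mab : (1 - t) * 1 `^ (beta / (beta - 1)) + t * 1 `^ (beta / (beta - 1)) = 1.
      by rewrite powR1 !mulr1 subrK.
    have h01 : 0 < (1 : R) <= 1 by rewrite ltr01 lexx.
    have t1' : 0 < 1 - t by rewrite subr_gt0.
    have := gibbs_geometric_mean beta_gt1 V_convex V_homog nu_gibbs f_ge0 g_ge0 h_ge0
      f_meas g_meas h_meas f_decr g_decr f_int g_int t1' t_gt0 (subrK _ _) mc ld
      h01 h01 mab ler01 ler01.
    rewrite !expr1n !mul1r /power_mean IJ eqxx; apply => x0 x1.
    apply: le_trans (fgh x0 x1); rewrite /power_mean eqxx !mul1r.
    case: ifPn => // /negP nfg.
    have [f0|f0] := eqVneq (f x0) 0; first by rewrite f0 powR0 ?gt_eqF// mul0r.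
    have [g0|g0] := eqVneq (g x1) 0; first by rewrite g0 [X in _ * X]powR0 ?gt_eqF// mulr0.
    by case: nfg; rewrite mulr_gt0// lt_neqAle eq_sym ?f0 ?g0 /=.
  rewrite /mean_index.
  have den : 0 < beta - 1 + beta * n%:R * s by rewrite addr_gt0// !mulr_gt0.
  have r0 : 0 < (beta - 1) * s / (beta - 1 + beta * n%:R * s).
    by rewrite divr_gt0// mulr_gt0.
  rewrite power_meanE//.
  (* The index [r] is the one with [1/r = 1/s + n beta / (beta - 1)]. *)
  apply: (gibbs_power_mean beta_gt1 t01 V_convex V_homog nu_gibbs f_ge0 g_ge0 h_ge0
    f_meas g_meas h_meas f_decr g_decr f_int g_int (k := s^-1)) => //.
    by field; rewrite !gt_eqF.
  move=> m l c d x0 x1 m0 l0 ml mc ld.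
  by apply: le_trans (fgh x0 x1); exact: power_mean_ge.
- move=> _ fgh; rewrite /mean_index.
  have r0 : 0 < (beta - 1) / (beta * n%:R) by rewrite divr_gt0// mulr_gt0.
  rewrite power_meanE//.
  (* The limit [k = 0] of [1/p], which leaves [1/r = n beta / (beta - 1)]. *)
  apply: (gibbs_power_mean beta_gt1 t01 V_convex V_homog nu_gibbs f_ge0 g_ge0 h_ge0
    f_meas g_meas h_meas f_decr g_decr f_int g_int (k := 0)) => //.
    by field; rewrite !gt_eqF.
  move=> m l c d x0 x1 m0 l0 ml mc ld.
  apply: le_trans (fgh x0 x1); rewrite !powRr0 !mul1r.
  exact: power_mean_infty_ge.
Qed.
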